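(* Let $0\le k\le n$ be integers and let $\Gamma$ be a proper circular arc graph on $n$ vertices that is obtained from a natural unit interval graph $G$ on $[n+k]$, whose first $k$ vertices form a clique and whose last $k$ vertices form a clique, by identifying $n+r$ with $r$ for each $1\le r\le k$. Let $\mathbf{G}=(G,(n+1,\dots,n+k),(1,\dots,k))$. For any $N\in\mathbb{N}$, \[ X_\Gamma(x_1,\dots,x_N)=\operatorname{tr}M_{\mathbf{G}}^{(N)}, \] which is $e$-positive, i.e. a polynomial in $e_1(x_1,\dots,x_N),\dots,e_N(x_1,\dots,x_N)$ with nonnegative coefficients. In particular, $\Gamma$ is $e$-positive: $X_\Gamma(\bm x)$, in infinitely many variables, has nonnegative coefficients in the elementary symmetric function basis.
   Context: Graphs are finite; when vertices are identified, parallel edges are suppressed, and $\Gamma$ has no loops. $X_\Gamma(\bm x)=\sum_\kappa\prod_{v\in V(\Gamma)}x_{\kappa(v)}$ is the chromatic symmetric function, summed over proper colorings $\kappa:V(\Gamma)\to\{1,2,\dots\}$; $X_\Gamma(x_1,\dots,x_N)$ is obtained by setting $x_c=0$ for $c>N$. A graph on $[m]=\{1,\dots,m\}$ is a natural unit interval graph if whenever $\{p,q\}$ is an edge with $p<q$, then $\{p,r\},\{r,q\}$ are edges for all $p<r<q$. A proper circular arc graph is the intersection graph of finitely many arcs of a circle, none of which contains another. Fix $N\in\mathbb{N}$, let $e_i=e_i(x_1,\dots,x_N)$ ($e_0=1$), let $I_j$ be the set of $j$-tuples of distinct elements of $[N]$, and let $V_j$ be the $\mathbb{Q}(x_1,\dots,x_N)$-vector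 space with basis $\{b_\sigma:\sigma\in I_j\}$ (so $V_j=0$ for $j>N$). For a tuple $\sigma$ of distinct positive integers set \[ A(1\mid\sigma)=\prod_r\frac{\sigma_r-1}{\sigma_r},\qquad A(\sigma_r+1\mid\sigma)=\frac{\sigma_r+1}{\sigma_r}\prod_{r'\ne r}\frac{\sigma_r-\sigma_{r'}+1}{\sigma_r-\sigma_{r'}}, \] and $A(y\mid\sigma)=0$ for all other $y$. Define $M_j^{(N)}\colon V_j\to V_{j+1}$ and $D_j\colon V_j\to V_{j-1}$ by \[ M_j^{(N)}b_\sigma=\sum_{y\in[N]\setminus\sigma}A(y\mid\sigma)\,b_{\sigma,y},\qquad D_jb_\sigma=\frac{e_{\sigma_1}}{e_{\sigma_1-1}}\,b_{\sigma_2,\dots,\sigma_j}, \] where $b_{\sigma,y}$ is indexed by $\sigma$ with $y$ appended. Definition of $M_{\mathbf{G}}^{(N)}\colon V_k\to V_k$. Build $G$ one vertex at a time, starting with the vertices $1,\dots,k$ marked. For $v=k+1,\dots,n+k$ in order, let $r$ be the number of neighbors of $v$ smaller than $v$; these are the $r$ most recently marked vertices. If currently $s$ vertices are marked, apply $D_s$, then $D_{s-1}$, ..., then $D_{r+1}$ (forgetting the oldest marked vertices), and then apply $M_r^{(N)}$ (so that $v$ and its smaller neighbors are marked). After the last vertex, apply operators $D$ in the same way until only the last $k$ vertices $n+1,\dots,n+k$ remain marked. $M_{\mathbf{G}}^{(N)}$ is the composition of all these operators, later steps on the left. *)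

(* Defs.v *)
From mathcomp Require Import all_boot all_order all_algebra.
From mathcomp Require Import finmap multiset mpoly.
From mathcomp Require Import reals.

Set Implicit Arguments.
Unset Strict Implicit.
Unset Printing Implicit Defensive.

Import Order.TTheory GRing.Theory Num.Theory.

Local Open Scope ring_scope.
Local Open Scope mset_scope.

(* Vertices and colors are numbered from 0: the vertex v of [m] is the element
   of 'I_m with value v - 1, and the color c >= 1 is the natural number c - 1
   (an element of 'I_N when the colors are [N]). *)

Section Graphs.

Definition clique (T : finType) (e : rel T) (A : {pred T}) : Prop :=
  forall p q, p \in A -> q \in A -> p != q -> e p q.

Definition natural_unit_interval m (G : rel 'I_m) : Prop :=
  [/\ ssrbool.symmetric G, irreflexive G &
      forall p r q : 'I_m, (p < r)%N -> (r < q)%N -> G p q -> G p r && G r q].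

(* The circle is R / Z, a point being given by any of its representatives. *)
Definition on_arc (R : realType) (l r x : R) : Prop :=
  exists z : int, l <= x + z%:~R <= r.

(* The vertex v is represented by the image in R / Z of [l v, r v]; the bounds
   on r v - l v say that this is neither a point nor the whole circle. *)
Definition proper_circular_arc (R : realType) (T : finType) (e : rel T) : Prop :=
  exists l r : T -> R,
    [/\ forall v, l v < r v < l v + 1,
        forall u v, u != v ->
          (e u v <-> exists x, on_arc (l u) (r u) x /\ on_arc (l v) (r v) x) &
        forall u v, u != v ->
          ~ (forall x, on_arc (l u) (r u) x -> on_arc (l v) (r v) x)].

(* The graph obtained from G by identifying n + i with i for all i < k, where
   k <= n: the vertex i < n of the result is the class of all vertices of G
   equal to i or to n + i. *)
Definition glue n k (G : rel 'I_(n + k)) : rel 'I_n := fun i j =>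
  [exists p : 'I_(n + k), exists q : 'I_(n + k),
     [&& (p == i :> nat) || (p == (n + i)%N :> nat),
         (q == j :> nat) || (q == (n + j)%N :> nat) & G p q]].

Definition proper_coloring (T : finType) (e : rel T) (C : eqType)
    (kappa : T -> C) : bool :=
  [forall u, forall v, e u v ==> (kappa u != kappa v)].

End Graphs.

Section FinitelyManyVariables.

Definition chrom_poly N (T : finType) (e : rel T) : {mpoly rat[N]} :=
  \sum_(kappa : {ffun T -> 'I_N} | proper_coloring e kappa)
    \prod_(v : T) 'X_(kappa v).

Definition e_positive_poly N (f : {mpoly rat[N]}) : Prop :=
  exists p : {mpoly rat[N]},
    (forall m, 0 <= p@_m) /\ f = p \mPo [tuple mesym N rat i.+1 | i < N].

End FinitelyManyVariables.

Section InfinitelyManyVariables.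

(* A formal power series in the variables x_c (c : nat) is the family of its
   coefficients; the multiset m stands for the monomial \prod_c x_c ^ (m c). *)
Definition series := {mset nat} -> rat.

Definition series1 : series := fun m => (m == mset0)%:R.

Definition submset (m : {mset nat})
    (a : {dffun forall c : finsupp m, 'I_(m (val c)).+1}) : {mset nat} :=
  [fsfun c : finsupp m => nat_of_ord (a c)].

(* Cauchy product: submset enumerates the divisors of the monomial m. *)
Definition series_mul (f g : series) : series := fun m =>
  \sum_(a : {dffun forall c : finsupp m, 'I_(m (val c)).+1})
    f (submset a) * g (m `\` submset a).

Definition e_series (i : nat) : series := fun m =>
  (uniq m && (size m == i))%:R.

Definition e_part (la : seq nat) : series :=
  foldr (fun i f => series_mul (e_series i) f) series1 la.

(* Only the finitely many colorings with values in the support of m can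
   contribute to the monomial m. *)
Definition chrom_series (T : finType) (e : rel T) : series := fun m =>
  #|[set kappa : {ffun T -> finsupp m} | proper_coloring e kappa &
       seq_mset [seq val (kappa v) | v <- enum T] == m]|%:R.

Definition is_partition (la : seq nat) : bool :=
  sorted geq la && (0%N \notin la).

Definition e_positive (f : series) : Prop :=
  exists (L : seq (seq nat)) (c : seq nat -> rat),
    [/\ uniq L, all is_partition L, forall la, la \in L -> 0 <= c la &
        forall m, f m = \sum_(la <- L) c la * e_part la m].

End InfinitelyManyVariables.

Section Operators.

(* The elements of the tuple s are the actual (positive) colors here. *)
Definition Acoef (y : nat) (s : seq nat) : rat :=
  if y == 1%N then \prod_(a <- s) ((a%:R - 1) / a%:R)
  else let b := y.-1 in
    if b \in s then
      (b%:R + 1) / b%:R *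
        \prod_(a <- s | a != b) ((b%:R - a%:R + 1) / (b%:R - a%:R))
    else 0.

Variable N : nat.

Definition ratfun : fieldType := {fraction {mpoly rat[N]}}.

Definition injtuple (j : nat) : finType := {s : j.-tuple 'I_N | uniq s}.

Definition dimV (j : nat) : nat := #|injtuple j|.

(* V_j is 'cV[ratfun]_(dimV j), the coordinates being indexed by injtuple j
   through enum_val. *)
Definition bvec (j : nat) (s : seq 'I_N) : 'cV[ratfun]_(dimV j) :=
  \col_i (tval (val (enum_val i)) == s)%:R.

(* The matrix of the linear map sending b_s to f s. *)
Definition lin_of_basis (j j' : nat) (f : seq 'I_N -> 'cV[ratfun]_(dimV j')) :
    'M[ratfun]_(dimV j', dimV j) :=
  \matrix_(a, c) f (tval (val (enum_val c))) a 0.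

Definition colors (s : seq 'I_N) : seq nat := [seq c.+1 | c : 'I_N <- s].

Definition Mop (j : nat) : 'M[ratfun]_(dimV j.+1, dimV j) :=
  lin_of_basis j (fun s =>
    \sum_(y : 'I_N | y \notin s)
      (tofrac (Acoef y.+1 (colors s))%:MP : ratfun) *: bvec j.+1 (rcons s y)).

(* The map D_(j+1) : V_(j+1) -> V_j. *)
Definition Dop (j : nat) : 'M[ratfun]_(dimV j, dimV j.+1) :=
  lin_of_basis j.+1 (fun s =>
    if s is c :: s' then
      (tofrac (mesym N rat c.+1) / tofrac (mesym N rat c) : ratfun) *: bvec j s'
    else 0).

(* forget r s = D_(r+1) o ... o D_s : V_s -> V_r for r <= s; it is 0 (and never
   used) for s < r.  When r = s, conform_mx casts the identity of V_s along
   the equality r = s. *)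
Fixpoint forget (r s : nat) : 'M[ratfun]_(dimV r, dimV s) :=
  if r == s then conform_mx 0 (1%:M : 'M[ratfun]_(dimV s))
  else match s with
       | 0 => 0
       | s'.+1 => forget r s' *m Dop s'
       end.

(* Starting with s marked vertices, adds one vertex for each entry of rs (its
   number of smaller neighbors), then forgets all but the last k vertices. *)
Fixpoint build (k s : nat) (rs : seq nat) : 'M[ratfun]_(dimV k, dimV s) :=
  match rs with
  | [::] => forget k s
  | r :: rs' => build k r.+1 rs' *m (Mop r *m forget r s)
  end.

Definition MG n k (G : rel 'I_(n + k)) : 'M[ratfun]_(dimV k) :=
  build k k [seq #|[set u : 'I_(n + k) | (u < v)%N && G u v]|
            | v : 'I_(n + k) <- enum 'I_(n + k) & (k <= v)%N].

End Operators.

(* Main.v *)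
Require Import Defs.
From HB Require Import structures.
From mathcomp Require Import all_boot all_order all_algebra.
From mathcomp Require Import finmap multiset mpoly.
From mathcomp Require Import reals boolp ring lra zify.

(* The proof compares the label operators M, D with the operators P, E that grow
   and forget the vertices of a coloured graph: P b_s is the sum of the b_(s,y)
   over the colours y outside s, and E forgets the first colour of s, with the
   variable of this colour as weight.  Expanding the trace of the word in P and E
   that G prescribes over colourings gives X_Gamma, so everything rests on an
   invertible family S_j : V_j -> V_j with S P = M S and S E = D S.

   Both pairs of operators belong to a representation of one algebra.  Besides P
   and E it contains the adjacent transpositions K_i of the positions (on labels,
   Young's seminormal form with contents the labels), and rho = P E - E P obeys the
   commutation rules of an affine symmetric group; then X = rho K_0 ... K_(j-1)
   and its conjugates commute, and on colours X multiplies b_s by the variable of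
   the last colour of s.  In the direct sum of the two representations let B_j be
   spanned by the X^m P v with v in B_(j-1), starting from the pair of vacuum vectors.
   The relations show that B is stable under P, E and the K_i, where the only scalars
   that enter are the E rho^m P on V_0; these are the power sums p_(m+1) on
   both sides.  Lagrange interpolation in X makes B_j surject onto the coloured V_j,
   interpolation in the first colour shows that (u, 0) in B_j forces u = 0, and
   so B_j is the graph of S_j.

   Positivity is read off the trace over labels: a labelling of non-zero weight sends
   each vertex with label c + 1 injectively to a neighbour with label c, so the
   number of labels c decreases with c, and the product of the e_c / e_(c-1) is a
   monomial in the e_c. *)

Set Implicit Arguments.
Unset Strict Implicit.
Unset Printing Implicit Defensive.

Import Order.TTheory GRing.Theory Num.Theory.

Local Open Scope ring_scope.

Lemma iter_comm (T U : Type) (g : T -> U) (f : T -> T) (f' : U -> U) m v :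
  (forall v, g (f v) = f' (g v)) -> g (iter m f v) = iter m f' (g v).
Proof. by move=> fg; elim: m => //= m IH; rewrite fg IH. Qed.

Lemma linear_iter (F : fieldType) (W : lmodType F) (f : {linear W -> W}) m : linear (iter m f).
Proof. by move=> a u v; elim: m => //= m ->; rewrite linearP. Qed.

(** * Linear spans of predicates *)

Section LinearSpan.

Variable F : fieldType.

Inductive lin_span (V : lmodType F) (S : V -> Prop) : V -> Prop :=
| lin_span0 : lin_span S 0
| lin_spanD a u v : S u -> lin_span S v -> lin_span S (a *: u + v).

Lemma mem_lin_span (V : lmodType F) (S : V -> Prop) u : S u -> lin_span S u.
Proof. by move=> Su; rewrite -[u]scale1r -[_ *: u]addr0; apply: lin_spanD (lin_span0 S). Qed.

Lemma lin_span_add (V : lmodType F) (S : V -> Prop) u v :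
  lin_span S u -> lin_span S v -> lin_span S (u + v).
Proof.
move=> Su Sv; elim: Su => [|a x y Sx _ IH]; first by rewrite add0r.
by rewrite -addrA; apply: lin_spanD.
Qed.

Lemma lin_span_scale (V : lmodType F) (S : V -> Prop) a v :
  lin_span S v -> lin_span S (a *: v).
Proof.
elim=> [|b x y Sx _ IH]; first by rewrite scaler0; apply: lin_span0.
by rewrite scalerDr scalerA; apply: lin_spanD.
Qed.

Lemma lin_span_linear (V W : lmodType F) (S : V -> Prop) (S' : W -> Prop)
    (f : V -> W) v :
  linear f -> (forall u, S u -> lin_span S' (f u)) -> lin_span S v -> lin_span S' (f v).
Proof.
move=> lf fS; elim=> [|a x y Sx _ IH]; last first.
  by rewrite lf; apply: lin_span_add => //; apply/lin_span_scale/fS.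
rewrite -[0]addr0 -{1}[0](scaler0 _ (-1)) lf scaleN1r addNr; exact: lin_span0.
Qed.

End LinearSpan.

(** * The exchange algebra *)

Section ExchangeAlgebra.

Variables (F : fieldType) (V : nat -> lmodType F).
Variables (P : forall j, {linear V j -> V j.+1}).
Variables (E : forall j, {linear V j.+1 -> V j}).
Variables (K : forall j, nat -> {linear V j -> V j}).

Definition rho j (v : V j.+1) : V j.+1 := P j (E j v) - E j.+1 (P j.+1 v).

Fact rho_linear j : linear (@rho j).
Proof.
move=> a u v; rewrite /rho !linearP /= addrACA -scalerDr //.
Qed.
HB.instance Definition _ j :=
  GRing.isLinear.Build F (V j.+1) (V j.+1) _ (@rho j) (@rho_linear j).

(* Moves the entry at position n of a tuple to position 0. *)
Fixpoint to_front j n (v : V j) : V j := if n is n'.+1 then to_front n' (K j n' v) else v.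

Fact to_front_linear j n : linear (@to_front j n).
Proof. by move=> a u v; elim: n u v => [//|n IH] u v /=; rewrite linearP IH. Qed.
HB.instance Definition _ j n :=
  GRing.isLinear.Build F (V j) (V j) _ (@to_front j n) (@to_front_linear j n).

(* On colours this multiplies b_s by the variable of the last colour of s. *)
Definition lastX j (v : V j.+1) : V j.+1 := rho (to_front j v).

Fact lastX_linear j : linear (@lastX j).
Proof. by move=> a u v; rewrite /lastX !linearP. Qed.
HB.instance Definition _ j :=
  GRing.isLinear.Build F (V j.+1) (V j.+1) _ (@lastX j) (@lastX_linear j).

(** Given the other relations, [rel_PPE] and [rel_PEE] say exactly that [rho] passes [P] and [E] at
    the cost of one transposition, in the form of [P_rho] and [rho_E]. *)
Record exchange_relations : Prop := ExchangeRelations {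
  rel_KK : forall j i v, (i.+1 < j)%N -> K j i (K j i v) = v;
  rel_braid : forall j i v, (i.+2 < j)%N ->
  K j i (K j i.+1 (K j i v)) = K j i.+1 (K j i (K j i.+1 v));
  rel_Kfar : forall j i i' v, (i.+1 < i')%N -> (i'.+1 < j)%N ->
  K j i (K j i' v) = K j i' (K j i v);
  rel_PK : forall j i v, (i.+1 < j)%N -> P j (K j i v) = K j.+1 i (P j v);
  rel_EK : forall j i v, (i.+1 < j)%N -> E j (K j.+1 i.+1 v) = K j i (E j v);
  rel_KPP : forall j v, K j.+2 j (P j.+1 (P j v)) = P j.+1 (P j v);
  rel_EEK : forall j v, E j (E j.+1 (K j.+2 0 v)) = E j (E j.+1 v);
  rel_PPE : forall j v,
  P j.+1 (P j (E j v)) + E j.+2 (P j.+2 (P j.+1 v)) =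
  P j.+1 (E j.+1 (P j.+1 v)) + K j.+2 j (P j.+1 (E j.+1 (P j.+1 v)));
  rel_PEE : forall j v,
  P j (E j (E j.+1 v)) + E j.+1 (E j.+2 (P j.+2 v)) =
  E j.+1 (P j.+1 (E j.+1 (v + K j.+2 0 v)))
}.

Hypothesis rel : exchange_relations.

Lemma K_rho j i v : (i.+1 < j)%N ->
  K j.+1 i (rho v) = rho (K j.+1 i.+1 v).
Proof.
move=> ij; rewrite /rho (rel_EK rel) // (rel_PK rel) // (rel_PK rel); last by rewrite !ltnS.
by rewrite (rel_EK rel) ?linearB // ltnW // ltnS.
Qed.

Lemma P_rho j v : P j.+1 (@rho j v) = K j.+2 j (rho (P j.+1 v)).
Proof.
rewrite /rho !linearB /=; apply/eqP.
rewrite subr_eq addrAC eq_sym subr_eq -(rel_EK rel) // (rel_KPP rel) addrC [X in _ == X]addrC.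
by rewrite -(rel_PPE rel) addrC.
Qed.

Lemma rho_E j v : rho (E j.+1 v) = E j.+1 (rho (K j.+2 0 v)).
Proof.
rewrite /rho !linearB /= (rel_PK rel) // (rel_EEK rel).
by apply/eqP; rewrite subr_eq addrAC eq_sym subr_eq (rel_PEE rel) !linearD addrC.
Qed.

(** With [K_rho] this makes [rho] behave as a rotation of the positions: two rotations carry the
    first pair of positions to the last pair. It follows by expanding the outer [rho] and moving the
    inner one past [P] and [E]. *)
Lemma rho_rho_K j (v : V j.+2) : rho (rho (K j.+2 0 v)) = K j.+2 j (rho (rho v)).
Proof.
rewrite {1}/rho -rho_E !P_rho (rel_EK rel) // (rel_PK rel) //.
by rewrite -rho_E -!raddfB.
Qed.

Lemma to_front_far j n i v : (n < i)%N -> (i.+1 < j)%N ->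
  K j i (to_front n v) = to_front n (K j i v).
Proof.
elim: n v => [//|n IH] v /= ni ij.
by rewrite IH ?(ltnW ni) // -(rel_Kfar rel).
Qed.

Lemma K_to_front j n i v : (i.+1 < n)%N -> (n < j)%N ->
  K j i.+1 (to_front n v) = to_front n (K j i v).
Proof.
elim: n v => [//|n IH] v /=; rewrite ltnS leq_eqVlt => /orP[/eqP <- nj|i_n nj].
  by rewrite /= to_front_far // -(rel_braid rel).
by rewrite IH ?(ltnW nj) // (rel_Kfar rel).
Qed.

Lemma P_to_front j n v : (n < j)%N -> P j (to_front n v) = to_front n (P j v).
Proof. by elim: n v => [//|n IH] v nj /=; rewrite IH ?(rel_PK rel) // ltnW. Qed.

Lemma K_lastX j i v : (i.+1 < j)%N -> K j.+1 i (lastX v) = lastX (K j.+1 i v).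
Proof. by move=> ij; rewrite /lastX K_rho // K_to_front. Qed.

(** Moves the entry at position n + 1 to position 1. This is [to_front n] on the part of a tuple
    that remains after [E]. *)
Fixpoint to_second j n (v : V j) : V j := if n is n'.+1 then to_second n' (K j n v) else v.

Lemma E_to_second j n v : (n < j)%N -> E j (to_second n v) = to_front n (E j v).
Proof. by elim: n v => [//|n IH] v nj /=; rewrite IH ?(rel_EK rel) // ltnW. Qed.

Lemma to_frontS j n v : to_front n.+1 v = K j 0 (to_second n v).
Proof. by elim: n v => [//|n IH] v; exact: IH (K j n.+1 v). Qed.

Lemma E_lastX j (v : V j.+2) : E j.+1 (lastX v) = lastX (E j.+1 v).
Proof. by rewrite /lastX to_frontS -E_to_second // rho_E. Qed.

(** After [P] the entry on which X acted is the last but one, so X appears conjugated by the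
    transposition of the last two positions. *)
Lemma P_lastX j (v : V j.+1) :
  P j.+1 (lastX v) = K j.+2 j (lastX (K j.+2 j (P j.+1 v))).
Proof. by rewrite /lastX P_rho P_to_front //= (rel_KK rel). Qed.

Lemma to_second_rho j n (v : V j.+1) : (n < j)%N -> rho (to_second n v) = to_front n (rho v).
Proof. by elim: n v => [//|n IH] v nj /=; rewrite IH -?K_rho // ltnW. Qed.

Lemma to_front_to_front j n m v : (m <= n)%N -> (n.+1 < j)%N ->
  to_front n.+1 (to_front m v) = to_second m (@to_front j n.+1 v).
Proof.
elim: m v => [//|m IH] v mn nj.
rewrite [to_front m.+1 v]/= IH ?(ltnW mn) //.
by rewrite -[RHS]/(to_second m (K j m.+1 (to_front n.+1 v))) K_to_front.
Qed.

(** Both sides become [rho] applied twice to a word in transpositions. The outer transposition on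
    the right enters this word as [K j.+2 0] by [rho_rho_K], and then the two words agree by
    [to_front_to_front]. *)
Lemma lastX_comm j (v : V j.+2) :
  lastX (K j.+2 j (lastX (K j.+2 j v))) = K j.+2 j (lastX (K j.+2 j (lastX v))).
Proof.
rewrite /lastX /= !(rel_KK rel) // -!to_second_rho // -rho_rho_K -to_frontS.
rewrite -!/(to_front j.+1 _) -[in LHS](rel_KK rel (i := j) v) //.
by rewrite -!/(to_front j.+1 _) -to_front_to_front.
Qed.

Variables (b : V 0) (p : nat -> F).
Hypothesis E_iter_rho : forall m v, E 0 (iter m (@rho 0) (P 0 v)) = p m *: v.

Fixpoint generated j : V j -> Prop :=
  match j with
  | 0 => fun v => exists a, v = a *: b
  | j'.+1 => lin_span (fun w => exists m u,
      generated u /\ w = iter m (@lastX j') (P j' u))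
  end.

Lemma generated0 j : generated (0 : V j).
Proof. by case: j => [|j]; [exists 0; rewrite scale0r | exact: lin_span0]. Qed.

Lemma generated_add j (u v : V j) : generated u -> generated v -> generated (u + v).
Proof.
case: j u v => [u v [a ->] [c ->]|j u v]; last exact: lin_span_add.
by exists (a + c); rewrite scalerDl.
Qed.

Lemma generated_scale j a (v : V j) : generated v -> generated (a *: v).
Proof.
case: j v => [v [c ->]|j v]; last exact: lin_span_scale.
by exists (a * c); rewrite scalerA.
Qed.

Lemma generated_opp j (v : V j) : generated v -> generated (- v).
Proof. by move=> gv; rewrite -scaleN1r; apply: generated_scale. Qed.

Lemma generated_P j v : generated v -> generated (P j v).
Proof. by move=> gv; apply: mem_lin_span; exists 0, v. Qed.

Lemma generated_lin_span j (S : V j -> Prop) :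
  (forall u, S u -> generated u) -> forall v, lin_span S v -> generated v.
Proof.
move=> gS v; elim=> [|a x y Sx _ IH]; first exact: generated0.
by apply: generated_add => //; apply/generated_scale/gS.
Qed.

Lemma generated_lin j i (f : V j.+1 -> V i) : linear f ->
  (forall m u, generated u -> generated (f (iter m (@lastX j) (P j u)))) ->
  forall v, generated v -> generated (f v).
Proof.
move=> lf gf v gv.
apply: (@generated_lin_span _ (@generated i) (fun u => id)).
apply: lin_span_linear gv => // _ [m [u [gu ->]]]; exact/mem_lin_span/gf.
Qed.

Lemma generated_lastX j (v : V j.+1) : generated v -> generated (lastX v).
Proof.
apply: generated_lin => [|m u gu]; [exact: linearP | rewrite -iterS].
by apply: mem_lin_span; exists m.+1, u.
Qed.

Lemma generated_iterX j m (v : V j.+1) :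
  generated v -> generated (iter m (@lastX j) v).
Proof. by move=> gv; elim: m => //= m IH; apply: generated_lastX. Qed.

(** Transpositions that avoid the last position commute with X and pass through P, so induction
    applies. The last transposition K exchanges X with its conjugate Y = K X K, which commutes with
    X, and it fixes P P w. Hence it sends X^m P X^l P w to X^l P X^m P w. *)
Lemma generated_K j i (v : V j) : (i.+1 < j)%N -> generated v -> generated (K j i v).
Proof.
elim: j i v => [//|j IHj] i v; rewrite ltnS leq_eqVlt => /orP[/eqP Dj | ij]; last first.
  apply: generated_lin => [|m u gu]; first exact: linearP.
  rewrite (iter_comm _ _ (fun v => K_lastX v ij)) -(rel_PK rel) //.
  by apply: generated_iterX; apply/generated_P/IHj.
subst j; apply: generated_lin => [|m u]; first exact: linearP.
(* As [f] is linear, the inner vector can be replaced by a generator X^l P w as well. *)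
pose f u := K i.+2 i (iter m (@lastX i.+1) (P i.+1 u)).
have lf : linear f by move=> a x y; rewrite /f linearP linear_iter linearP.
move: u; apply: (generated_lin lf) => l w gw; rewrite /f {f lf v}.
pose Y v := K i.+2 i (lastX (K i.+2 i v)).
have KX v : K i.+2 i (lastX v) = Y (K i.+2 i v) by rewrite /Y (rel_KK rel).
have KY v : K i.+2 i (Y v) = lastX (K i.+2 i v) by rewrite /Y (rel_KK rel).
have XY k k' v : iter k Y (iter k' (@lastX i.+1) v) = iter k' (@lastX i.+1) (iter k Y v).
  by elim: k => //= k ->; apply: iter_comm => x; rewrite /Y lastX_comm.
have PX k v : P i.+1 (iter k (@lastX i) v) = iter k Y (P i.+1 v).
  by apply: iter_comm => x; rewrite P_lastX.
rewrite (iter_comm _ _ KX) PX (iter_comm _ _ KY) (rel_KPP rel) XY -PX.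
apply: generated_iterX; apply: generated_P.
by apply: generated_iterX; apply: generated_P.
Qed.

Lemma generated_to_front j n (v : V j) : (n < j)%N -> generated v -> generated (to_front n v).
Proof. by elim: n v => [//|n IH] v nj gv /=; apply: IH (ltnW nj) _; apply: generated_K. Qed.

(** The transpositions are involutions, so [to_front n] can be undone within the generated vectors.
    This reduces [rho] to X. *)
Lemma to_front_surj j n (v : V j) : (n < j)%N ->
  exists2 u, (generated v -> generated u) & v = to_front n u.
Proof.
elim: n => [|n IH] nj; first by exists v.
have [u gu Dv] := IH (ltnW nj).
exists (K j n u); last by rewrite /= (rel_KK rel).
by move=> gv; apply: generated_K => //; apply: gu.
Qed.

Lemma generated_rho j (v : V j.+1) : generated v -> generated (rho v).
Proof.
by move=> gv; have [u gu ->] := to_front_surj v (ltnSn j); apply/generated_lastX/gu.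
Qed.

(** On V_1 the operators X and [rho] coincide, and E rho^m P is a scalar by [E_iter_rho]. Higher up,
    E passes through the powers of X, and E P = P E - rho leads back to the induction hypothesis. *)
Lemma generated_E j (v : V j.+1) : generated v -> generated (E j v).
Proof.
elim: j v => [|j IH] v; (apply: generated_lin => [|m u gu]; first exact: linearP).
  have -> : iter m (@lastX 0) (P 0 u) = iter m (@rho 0) (P 0 u) by [].
  by rewrite E_iter_rho; apply: generated_scale.
rewrite (iter_comm _ _ (@E_lastX j)); apply: generated_iterX.
have -> : E j.+1 (P j.+1 u) = P j (E j u) - rho u by rewrite /rho subKr.
apply: generated_add; first exact/generated_P/IH.
exact/generated_opp/generated_rho.
Qed.

End ExchangeAlgebra.

Lemma perm_swap (T : eqType) (x y : T) s : perm_eq [:: x, y & s] [:: y, x & s].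
Proof.
rewrite -[[:: x, y & s]]/([:: x; y] ++ s) -[[:: y, x & s]]/([:: y; x] ++ s).
by rewrite perm_cat2r (perm_catC [:: x] [:: y]).
Qed.

(** * Representations on tuples given by coefficients *)

Section ExchangeSystem.

Variables (F : fieldType) (T : finType).
Variables (a : T -> seq T -> F) (w : T -> F) (c : T -> T -> F).

(* The weight w does not occur: in each relation that involves E, both sides carry the
   same weights.  On colours c = 0; on labels c x y = - (x - y)^-1. *)
Record exchange_system : Prop := ExchangeSystem {
  es_anti : forall x y, c y x = - c x y;
  es_add : forall x y z, x != y -> y != z -> x != z ->
    c x y * c y z = c x z * (c x y + c y z);
  es_perm : forall y s s', perm_eq s s' -> a y s = a y s';
  es_mem : forall y s, uniq s -> y \in s -> a y s = 0;
  es_PP : forall s y z, uniq s -> y != z -> y \notin s -> z \notin s ->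
    (1 - c y z) * (a y s * a z (y :: s)) = (1 + c y z) * (a z s * a y (z :: s));
  es_PPE : forall x s y z, uniq (x :: s) -> y != z -> y \notin s -> z \notin s ->
    a y s * a z (y :: s) + a y (x :: s) * a z [:: x, y & s] =
    (1 + c y z) * (a y (x :: s) * a z (y :: s) + a z (x :: s) * a y (z :: s));
  es_PEE : forall x y s z, uniq [:: x, y & s] -> z \notin s ->
    a z s + a z [:: x, y & s] = (1 + c x y) * a z (y :: s) + (1 - c x y) * a z (x :: s)
}.

Variables (V : nat -> lmodType F) (bv : forall j, seq T -> V j).
Variables (P : forall j, {linear V j -> V j.+1}).
Variables (E : forall j, {linear V j.+1 -> V j}).
Variables (K : forall j, nat -> {linear V j -> V j}).

(** [bv j s] stands for b_s and is 0 when [s] has a repetition, so that the sum in [ea_P] may run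
    over all of [T]. [ea_ext] expresses that these vectors span V_j. *)
Record exchange_action : Prop := ExchangeAction {
  ea_uniq : forall j s, ~~ uniq s -> bv j s = 0;
  ea_ext : forall j i (f g : V j -> V i), linear f -> linear g ->
    (forall s, uniq s -> size s = j -> f (bv j s) = g (bv j s)) -> f =1 g;
  ea_P : forall j s, P j (bv j s) = \sum_y a y s *: bv j.+1 (rcons s y);
  ea_E : forall j x s, x \notin s -> E j (bv j.+1 (x :: s)) = w x *: bv j s;
  ea_K : forall j i p x y s, size p = i ->
    K j i (bv j (p ++ [:: x, y & s])) =
    (1 - c x y) *: bv j (p ++ [:: y, x & s]) + c x y *: bv j (p ++ [:: x, y & s])
}.

Hypotheses (es : exchange_system) (ea : exchange_action).

Lemma split2 i (s : seq T) : (i.+1 < size s)%N -> exists p x y r,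
  size p = i /\ s = p ++ [:: x, y & r].
Proof.
move=> lt_is; have x0 : T by case: s lt_is.
exists (take i s), (nth x0 s i), (nth x0 s i.+1), (drop i.+2 s).
rewrite size_takel ?(ltnW (ltnW lt_is)) //; split=> //.
by rewrite -!drop_nth ?cat_take_drop // ltnW.
Qed.

Lemma split3 i (s : seq T) : (i.+2 < size s)%N -> exists p x y z r,
  size p = i /\ s = p ++ [:: x, y, z & r].
Proof.
move=> lt_is; have [p [x [y [r [pi Ds]]]]] := split2 (ltnW lt_is).
case: r => [|z r] in Ds *; last by exists p, x, y, z, r.
by move: lt_is; rewrite Ds size_cat pi addn2 ltnn.
Qed.

Lemma K_invol j i v : (i.+1 < j)%N -> K j i (K j i v) = v.
Proof.
move=> ij; apply: (ea_ext ea (f := K j i \o K j i) (g := id)) => [||s us js].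
- exact: linearP.
- by [].
rewrite -js in ij; have [p [x [y [r [pi ->]]]]] := split2 ij.
rewrite /= (ea_K ea) // linearD !linearZ /= !(ea_K ea) // (es_anti es x y).
rewrite !scalerDr !scalerA [X in _ + X]addrC addrACA -!scalerDl.
rewrite [X in X *: _ + _](_ : _ = 1) ?[X in _ + X *: _](_ : _ = 0); try ring.
by rewrite scale0r scale1r addr0.
Qed.

Lemma K_braid j i v : (i.+2 < j)%N ->
  K j i (K j i.+1 (K j i v)) = K j i.+1 (K j i (K j i.+1 v)).
Proof.
move=> ij; apply: (ea_ext ea (f := K j i \o (K j i.+1 \o K j i))
  (g := K j i.+1 \o (K j i \o K j i.+1))) => [||s us js].
- exact: linearP.
- exact: linearP.
rewrite -js in ij; have [p [x [y [z [r [pi Ds]]]]]] := split3 ij.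
have [xy yz xz] : [/\ x != y, y != z & x != z].
  move: us; rewrite Ds cat_uniq => /and3P[_ _ /=]; rewrite !inE !negb_or.
  by case/and3P=> /and3P[-> -> _] /andP[-> _] _.
have add_c := es_add es xy yz xz.
have Kl x' y' z' : K j i (bv j (p ++ [:: x', y', z' & r])) =
  (1 - c x' y') *: bv j (p ++ [:: y', x', z' & r]) + c x' y' *: bv j (p ++ [:: x', y', z' & r]).
  by rewrite (ea_K ea).
have Kr x' y' z' : K j i.+1 (bv j (p ++ [:: x', y', z' & r])) =
  (1 - c y' z') *: bv j (p ++ [:: x', z', y' & r]) + c y' z' *: bv j (p ++ [:: x', y', z' & r]).
  by rewrite -!(cat_rcons x') (ea_K ea) // size_rcons pi.
rewrite Ds /= {Ds}; move: (bv j) (K j i) (K j i.+1) Kl Kr => b k1 k2 Kl Kr.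
rewrite Kl Kr !linearD !linearZ /= !Kl !Kr !linearD !linearZ /= !Kl !Kr.
rewrite (es_anti es x y) (es_anti es y z) !scalerDr !scalerA.
(* The eight terms of each side are sorted by the six arrangements of x, y, z; on each side two of
   the arrangements arise twice. *)
rewrite [LHS](AC ((2*2)*(2*2)) (1*2*5*6*(4*7)*(3*8)))%AC.
rewrite [RHS](AC ((2*2)*(2*2)) (1*5*2*(4*7)*6*(3*8)))%AC /= -!scalerDl.
by congr (_ *: _ + _ *: _ + _ *: _ + _ *: _ + _ *: _ + _ *: _); ring: add_c.
Qed.

Lemma K_far j i i' v : (i.+1 < i')%N -> (i'.+1 < j)%N ->
  K j i (K j i' v) = K j i' (K j i v).
Proof.
move=> ii' ij; apply: (ea_ext ea (f := K j i \o K j i')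
  (g := K j i' \o K j i)) => [||s us js].
- exact: linearP.
- exact: linearP.
rewrite -js in ij; have [p [x [y [r [pi' Ds]]]]] := split2 ij.
have lt_ip : (i.+1 < size p)%N by rewrite pi'.
have [q [x' [y' [q' [qi Dp]]]]] := split2 lt_ip.
rewrite Ds Dp /= -!catA /=.
have Kl x1 y1 x2 y2 : K j i (bv j (q ++ [:: x1, y1 & q' ++ [:: x2, y2 & r]])) =
  (1 - c x1 y1) *: bv j (q ++ [:: y1, x1 & q' ++ [:: x2, y2 & r]]) +
  c x1 y1 *: bv j (q ++ [:: x1, y1 & q' ++ [:: x2, y2 & r]]) by rewrite (ea_K ea).
have Kr x1 y1 x2 y2 : K j i' (bv j (q ++ [:: x1, y1 & q' ++ [:: x2, y2 & r]])) =
  (1 - c x2 y2) *: bv j (q ++ [:: x1, y1 & q' ++ [:: y2, x2 & r]]) +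
  c x2 y2 *: bv j (q ++ [:: x1, y1 & q' ++ [:: x2, y2 & r]]).
  have catE t : q ++ [:: x1, y1 & q' ++ t] = (q ++ [:: x1, y1 & q']) ++ t by rewrite -catA.
  by rewrite !catE (ea_K ea) // -[RHS]pi' Dp !size_cat.
rewrite Kl Kr !linearD !linearZ /= !Kl !Kr !scalerDr !scalerA addrACA.
by rewrite ![_ * (1 - c x y)]mulrC ![_ * c x y]mulrC.
Qed.

Lemma P_K j i v : (i.+1 < j)%N -> P j (K j i v) = K j.+1 i (P j v).
Proof.
move=> ij; apply: (ea_ext ea (f := P j \o K j i)
  (g := K j.+1 i \o P j)) => [||s us js].
- exact: linearP.
- exact: linearP.
rewrite -js in ij; have [p [x [y [r [pi Ds]]]]] := split2 ij.
rewrite Ds /= (ea_K ea) // linearD !linearZ /= !(ea_P ea) [RHS]linear_sum.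
rewrite !scaler_sumr -big_split; apply: eq_bigr => z _ /=.
have -> : a z (p ++ [:: y, x & r]) = a z (p ++ [:: x, y & r]).
  by apply: (es_perm es); rewrite perm_cat2l perm_swap.
rewrite [RHS]linearZ /= !rcons_cat /= (ea_K ea) // scalerDr !scalerA.
by congr (_ *: _ + _ *: _); rewrite mulrC.
Qed.

Lemma E_K j i v : (i.+1 < j)%N -> E j (K j.+1 i.+1 v) = K j i (E j v).
Proof.
move=> ij; apply: (ea_ext ea (f := E j \o K j.+1 i.+1)
  (g := K j i \o E j)) => [||s us js].
- exact: linearP.
- exact: linearP.
case: s us js => [//|t s] /= /andP[ts us] [js]; rewrite -js in ij.
have [p [x [y [r [pi Ds]]]]] := split2 ij.
rewrite Ds in ts *; rewrite -cat_cons (ea_K ea) /= ?pi //.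
rewrite linearD !linearZ /= !(ea_E ea) //; last first.
  by move: ts; rewrite !mem_cat !inE !negb_or => /and4P[-> -> -> ->].
by rewrite [RHS]linearZ /= (ea_K ea) // scalerDr !scalerA ![w t * _]mulrC.
Qed.

(** The general vector obtained by appending two entries to [s]. In this form the relations that
    contain P twice become identities between coefficient functions. *)
Definition pair_sum j (s : seq T) (g : T -> T -> F) : V j.+2 :=
  \sum_y \sum_z g y z *: bv j.+2 (rcons (rcons s y) z).

Lemma pair_sum_PP j (s : seq T) :
  P j.+1 (P j (bv j s)) = pair_sum j s (fun y z => a y s * a z (rcons s y)).
Proof.
rewrite (ea_P ea) linear_sum; apply: eq_bigr => y _.
rewrite linearZ /= (ea_P ea) scaler_sumr; apply: eq_bigr => z _.
by rewrite scalerA.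
Qed.

Lemma eq_pair_sum j (s : seq T) g g' :
  (forall y z, y != z -> y \notin s -> z \notin s -> g y z = g' y z) ->
  pair_sum j s g = pair_sum j s g'.
Proof.
move=> eq_g; apply: eq_bigr => y _; apply: eq_bigr => z _.
have [|] := boolP (uniq (rcons (rcons s y) z)); last first.
  by move=> /(ea_uniq ea) ->; rewrite !scaler0.
rewrite !rcons_uniq mem_rcons inE negb_or => /and3P[/andP[zy zs] ys _].
by rewrite eq_g // eq_sym.
Qed.

Lemma K_pair_sum j (s : seq T) g : size s = j ->
  K j.+2 j (pair_sum j s g) =
  pair_sum j s (fun y z => (1 - c z y) * g z y + c y z * g y z).
Proof.
move=> js; rewrite linear_sum /=.
transitivity (\sum_y \sum_z ((g y z * (1 - c y z)) *: bv j.+2 (rcons (rcons s z) y)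
   + (g y z * c y z) *: bv j.+2 (rcons (rcons s y) z))).
  apply: eq_bigr => y _; rewrite linear_sum; apply: eq_bigr => z _ /=.
  rewrite linearZ /= -!cats1 -!catA /= (ea_K ea) // scalerDr !scalerA.
  by [].
under eq_bigr do rewrite big_split.
rewrite big_split exchange_big -big_split; apply: eq_bigr => y _ /=.
rewrite -big_split; apply: eq_bigr => z _ /=.
by rewrite -scalerDl mulrC [g y z * _]mulrC.
Qed.

Lemma pair_sum_add j (s : seq T) g g' :
  pair_sum j s g + pair_sum j s g' = pair_sum j s (fun y z => g y z + g' y z).
Proof.
rewrite -big_split; apply: eq_bigr => y _; rewrite -big_split.
by apply: eq_bigr => z _; rewrite scalerDl.
Qed.

Lemma a_rcons y x s : a y (rcons s x) = a y (x :: s).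
Proof. by apply: (es_perm es); rewrite perm_rcons. Qed.

Lemma K_PP j v : K j.+2 j (P j.+1 (P j v)) = P j.+1 (P j v).
Proof.
apply: (ea_ext ea (f := K j.+2 j \o (P j.+1 \o P j)) (g := P j.+1 \o P j)) => [||s us js].
- exact: linearP.
- exact: linearP.
rewrite /= pair_sum_PP K_pair_sum //; apply: eq_pair_sum => y z yz ys zs.
rewrite !a_rcons (es_anti es y z) opprK -(es_PP es) //; ring.
Qed.

Lemma K0_bv j x y s : K j 0 (bv j [:: x, y & s]) =
  (1 - c x y) *: bv j [:: y, x & s] + c x y *: bv j [:: x, y & s].
Proof. by move/(_ j 0 [::] x y s erefl): (ea_K ea). Qed.

Lemma E_E_bv j x y s : uniq [:: x, y & s] ->
  E j (E j.+1 (bv j.+2 [:: x, y & s])) = (w x * w y) *: bv j s.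
Proof.
by case/andP=> xs /andP[ys us]; rewrite (ea_E ea) // linearZ /= (ea_E ea) // scalerA.
Qed.

Lemma E_E_K j v : E j (E j.+1 (K j.+2 0 v)) = E j (E j.+1 v).
Proof.
apply: (ea_ext ea (f := E j \o (E j.+1 \o K j.+2 0)) (g := E j \o E j.+1)) => [||s us js].
- exact: linearP.
- exact: linearP.
case: s us js => [//|x [//|y s]] us js.
rewrite /= K0_bv !linearD ![E j.+1 (_ *: _)]linearZ /= ![E j (_ *: _)]linearZ /=.
have us' : uniq [:: y, x & s] by rewrite -(perm_uniq (perm_swap x y s)).
rewrite !E_E_bv // !scalerA -scalerDl; congr (_ *: _); ring.
Qed.

(** For y = x the rule for [E] does not apply, as x then occurs twice, but in this case the
    coefficient is 0. *)
Lemma scaled_E j x s y k : x \notin s -> uniq s ->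
  (k * a y (x :: s)) *: E j (bv j.+1 (x :: rcons s y)) =
  (w x * (k * a y (x :: s))) *: bv j (rcons s y).
Proof.
move=> xs us; have [->|yx] := eqVneq y x.
  by rewrite (es_mem es) ?mulr0 ?scale0r //= ?xs // mem_head.
by rewrite (ea_E ea) ?scalerA 1?mulrC // mem_rcons inE negb_or eq_sym yx.
Qed.

Lemma E_P_bv j x s : x \notin s -> uniq s ->
  E j.+1 (P j.+1 (bv j.+1 (x :: s))) = w x *: \sum_y a y (x :: s) *: bv j.+1 (rcons s y).
Proof.
move=> xs us; rewrite (ea_P ea) linear_sum scaler_sumr; apply: eq_bigr => y _ /=.
by rewrite linearZ /= -[a y _]mul1r scaled_E // scalerA.
Qed.

Lemma P_P_E j v :
  P j.+1 (P j (E j v)) + E j.+2 (P j.+2 (P j.+1 v)) =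
  P j.+1 (E j.+1 (P j.+1 v)) + K j.+2 j (P j.+1 (E j.+1 (P j.+1 v))).
Proof.
apply: (ea_ext ea (f := (P j.+1 \o (P j \o E j)) \+ (E j.+2 \o (P j.+2 \o P j.+1)))
  (g := (P j.+1 \o (E j.+1 \o P j.+1)) \+ (K j.+2 j \o (P j.+1 \o (E j.+1 \o P j.+1)))))
  => [||s us js].
- exact: linearP.
- exact: linearP.
case: s us js => [//|x s] /= /andP[xs us] [js].
have -> : P j.+1 (E j.+1 (P j.+1 (bv j.+1 (x :: s)))) =
  w x *: pair_sum j s (fun y z => a y (x :: s) * a z (rcons s y)).
  rewrite E_P_bv // linearZ linear_sum /=; congr (_ *: _); apply: eq_bigr => y _.
  rewrite linearZ /= (ea_P ea) scaler_sumr; apply: eq_bigr => z _.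
  by rewrite scalerA.
have -> : E j.+2 (P j.+2 (P j.+1 (bv j.+1 (x :: s)))) =
  w x *: pair_sum j s (fun y z => a y (x :: s) * a z (x :: rcons s y)).
  rewrite pair_sum_PP linear_sum scaler_sumr; apply: eq_bigr => y _.
  rewrite linear_sum scaler_sumr; apply: eq_bigr => z _ /=.
  rewrite linearZ /=; have [us'|us'] := boolP (uniq (rcons (x :: s) y)).
    rewrite scaled_E ?scalerA //; move: us'; rewrite rcons_cons /=; by case/andP.
  have [/eqP Dy|yx] := boolP (y == x).
    by rewrite Dy (es_mem es) ?mul0r ?scale0r ?scaler0 //= ?xs // mem_head.
  have ys : y \in s.
    apply: contraR us' => ys; rewrite rcons_uniq inE negb_or yx ys /= xs //.
  by rewrite (es_mem es) ?mul0r ?scale0r ?scaler0 //= ?xs ?inE // ys orbT.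
rewrite (ea_E ea) // !linearZ /= pair_sum_PP K_pair_sum // -!scalerDr !pair_sum_add.
congr (_ *: _); apply: eq_pair_sum => y z yz ys zs.
have -> : a z (x :: rcons s y) = a z [:: x, y & s].
  by apply: (es_perm es); rewrite perm_cons perm_rcons.
rewrite !a_rcons (es_PPE es) //= ?xs // (es_anti es y z); ring.
Qed.

Lemma E_P_E_bv j x y s : uniq [:: x, y & s] ->
  E j.+1 (P j.+1 (E j.+1 (bv j.+2 [:: x, y & s]))) =
  (w x * w y) *: \sum_z a z (y :: s) *: bv j.+1 (rcons s z).
Proof.
case/and3P=> xs ys us; rewrite (ea_E ea) // [P _ _]linearZ [LHS]linearZ /=.
by rewrite E_P_bv // scalerA.
Qed.

Lemma E_E_P_bv j x y s : uniq [:: x, y & s] ->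
  E j.+1 (E j.+2 (P j.+2 (bv j.+2 [:: x, y & s]))) =
  (w x * w y) *: \sum_z a z [:: x, y & s] *: bv j.+1 (rcons s z).
Proof.
move=> us; rewrite (ea_P ea) !linear_sum; apply: eq_bigr => z _ /=.
have [zs|zs] := boolP (z \in [:: x, y & s]).
  by rewrite (es_mem es us zs) !scale0r !linear0.
rewrite [E j.+2 _]linearZ [LHS]linearZ /= E_E_bv ?scalerA 1?mulrC //.
by rewrite -!rcons_cons rcons_uniq zs.
Qed.

Lemma P_E_E j v :
  P j (E j (E j.+1 v)) + E j.+1 (E j.+2 (P j.+2 v)) =
  E j.+1 (P j.+1 (E j.+1 (v + K j.+2 0 v))).
Proof.
apply: (ea_ext ea (f := (P j \o (E j \o E j.+1)) \+ (E j.+1 \o (E j.+2 \o P j.+2)))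
  (g := E j.+1 \o (P j.+1 \o (E j.+1 \o (idfun \+ K j.+2 0))))) => [||s us js].
- exact: linearP.
- exact: linearP.
case: s us js => [//|x [//|y s]] us js; rewrite /= K0_bv.
have us' : uniq [:: y, x & s] by rewrite -(perm_uniq (perm_swap x y s)).
have xs : x \notin s by case/andP: us; rewrite inE negb_or => /andP[].
rewrite E_E_bv // E_E_P_bv // [P j (_ *: _)]linearZ /= (ea_P ea).
rewrite addrCA -[X in _ + (X + _)]scale1r -scalerDl !linearD ![E _ (_ *: _)]linearZ /=.
rewrite ![P _ (_ *: _)]linearZ /= ![E _ (_ *: _)]linearZ /= !E_P_E_bv // [w y * w x]mulrC.
rewrite !scalerA ![_ * (w x * w y)]mulrC -!scalerA -!scalerDr; congr (_ *: (_ *: _)).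
rewrite !scaler_sumr -!big_split; apply: eq_bigr => z _ /=.
have [zs|zs] := boolP (z \in s).
  by rewrite (ea_uniq ea) ?scaler0 ?addr0 // rcons_uniq zs.
by rewrite !scalerA -!scalerDl (es_PEE es) // addrC.
Qed.

Lemma exchange_relations_of_system : exchange_relations P E K.
Proof.
split; [exact: K_invol | exact: K_braid | exact: K_far | exact: P_K | exact: E_K
  | exact: K_PP | exact: E_E_K | exact: P_P_E | exact: P_E_E].
Qed.

End ExchangeSystem.

(** * Lagrange interpolation in an operator *)

Section Interpolation.

Variables (F : fieldType) (T : finType) (x : T -> F).

(* Lagrange interpolation: projects onto the eigenspace of X for the eigenvalue x a. *)
Definition interp (W : lmodType F) (X : W -> W) (a : T) (v : W) : W :=
  foldr (fun z u => (x a - x z)^-1 *: (X u - x z *: u)) v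
    [seq z <- enum T | z != a].

Lemma linear_interp (W : lmodType F) (X : {linear W -> W}) a : linear (interp X a).
Proof.
rewrite /interp => k u v; elim: [seq _ <- _ | _] => //= z s ->.
rewrite [X _]linearP [x z *: (_ + _)]scalerDr opprD addrACA scalerDr; congr (_ + _).
by rewrite scalerA mulrC -scalerA -scalerBr !scalerA mulrC.
Qed.
HB.instance Definition _ (W : lmodType F) (X : {linear W -> W}) a :=
  GRing.isLinear.Build F W W _ (interp X a) (@linear_interp W X a).

Lemma interp_closed (W : lmodType F) (X : W -> W) (S : W -> Prop) a v :
  (forall u, S u -> S (X u)) -> (forall k u, S u -> S (k *: u)) ->
  (forall u u', S u -> S u' -> S (u + u')) -> S v -> S (interp X a v).
Proof.
rewrite /interp => SX SZ SD Sv; elim: [seq _ <- _ | _] => //= z s IH.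
by apply/SZ/SD; [apply: SX | rewrite -scaleNr; apply: SZ].
Qed.

Hypothesis x_inj : injective x.

Lemma interp_eigen (W : lmodType F) (X : {linear W -> W}) a b v :
  X v = x b *: v -> interp X a v = (b == a)%:R *: v.
Proof.
rewrite /interp => Xv.
have -> : foldr (fun z u => (x a - x z)^-1 *: (X u - x z *: u)) v
    [seq z <- enum T | z != a] =
  (\prod_(z <- [seq z <- enum T | z != a]) ((x a - x z)^-1 * (x b - x z))) *: v.
  elim: [seq _ <- _ | _] => [|z s /= ->]; first by rewrite big_nil scale1r.
  rewrite big_cons [X _]linearZ /= Xv !scalerA -scalerBl scalerA [_ * x b]mulrC.
  by rewrite -mulrBl mulrA.
rewrite big_filter big_enum_cond /=; congr (_ *: v); have [->|ba] := eqVneq b a.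
  by rewrite big1 // => z za; rewrite mulVf // subr_eq0 (inj_eq x_inj) eq_sym.
by rewrite (bigD1 b) //= subrr mulr0 mul0r.
Qed.

End Interpolation.

(** * Direct sums of representations *)

Section DirectSum.

Variables (F : fieldType) (V1 V2 : nat -> lmodType F).

Section Pair.
Variables (U1 U2 W1 W2 : lmodType F) (f1 : {linear U1 -> W1}) (f2 : {linear U2 -> W2}).
Definition pair_map (v : U1 * U2) : W1 * W2 := (f1 v.1, f2 v.2).
Fact pair_map_linear : linear pair_map.
Proof. by move=> k u v; rewrite /pair_map /= !linearP. Qed.
HB.instance Definition _ :=
  GRing.isLinear.Build F (U1 * U2)%type (W1 * W2)%type _ pair_map pair_map_linear.
End Pair.

Variables (P1 : forall j, {linear V1 j -> V1 j.+1})
  (P2 : forall j, {linear V2 j -> V2 j.+1}).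
Variables (E1 : forall j, {linear V1 j.+1 -> V1 j})
  (E2 : forall j, {linear V2 j.+1 -> V2 j}).
Variables (K1 : forall j, nat -> {linear V1 j -> V1 j})
  (K2 : forall j, nat -> {linear V2 j -> V2 j}).

Definition sumV j : lmodType F := (V1 j * V2 j)%type.
Definition sumP j : {linear sumV j -> sumV j.+1} := pair_map (P1 j) (P2 j).
Definition sumE j : {linear sumV j.+1 -> sumV j} := pair_map (E1 j) (E2 j).
Definition sumK j i : {linear sumV j -> sumV j} := pair_map (K1 j i) (K2 j i).

Lemma sum_relations : exchange_relations P1 E1 K1 -> exchange_relations P2 E2 K2 ->
  exchange_relations sumP sumE sumK.
Proof.
move=> [a1 a2 a3 a4 a5 a6 a7 a8 a9] [b1 b2 b3 b4 b5 b6 b7 b8 b9].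
split=> [j i v ij|j i v ij|j i i' v ii' ij|j i v ij|j i v ij|j v|j v|j v|j v];
  (apply: injective_projections => /=; [
   (exact: a1 || exact: a2 || exact: a3 || exact: a4 || exact: a5 || exact: a6 ||
    exact: a7 || exact: a8 || exact: a9) |
   (exact: b1 || exact: b2 || exact: b3 || exact: b4 || exact: b5 || exact: b6 ||
    exact: b7 || exact: b8 || exact: b9)]).
Qed.

Lemma sum_to_front j n (v : sumV j) : to_front sumK n v = (to_front K1 n v.1, to_front K2 n v.2).
Proof. by elim: n v => [[]//|n IH] v /=; rewrite IH. Qed.

End DirectSum.

(** * Comparison of two representations *)

Section Comparison.

Variables (F : fieldType) (T : finType).
Variables (a1 a2 : T -> seq T -> F) (w1 w2 : T -> F) (c1 c2 : T -> T -> F).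
Variables (V1 V2 : nat -> lmodType F).
Variables (bv1 : forall j, seq T -> V1 j) (bv2 : forall j, seq T -> V2 j).
Variables (P1 : forall j, {linear V1 j -> V1 j.+1})
  (P2 : forall j, {linear V2 j -> V2 j.+1}).
Variables (E1 : forall j, {linear V1 j.+1 -> V1 j})
  (E2 : forall j, {linear V2 j.+1 -> V2 j}).
Variables (K1 : forall j, nat -> {linear V1 j -> V1 j})
  (K2 : forall j, nat -> {linear V2 j -> V2 j}).
Hypotheses (es1 : exchange_system a1 c1) (es2 : exchange_system a2 c2).
Hypotheses (ea1 : exchange_action a1 w1 c1 bv1 P1 E1 K1).
Hypotheses (ea2 : exchange_action a2 w2 c2 bv2 P2 E2 K2).

Hypothesis a1E : forall y s, a1 y s = (y \notin s)%:R.
Hypothesis c1E : forall y z, c1 y z = 0.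
Hypothesis w1_inj : injective w1.
Hypothesis w1_neq0 : forall y, w1 y != 0.
Variable cons1 : T -> forall j, {linear V1 j -> V1 j.+1}.
Hypothesis cons1E : forall y j s, cons1 y j (bv1 j s) = bv1 j.+1 (y :: s).

Variable p : nat -> F.
Hypothesis E_rho1 : forall m v, E1 0 (iter m (@rho _ _ P1 E1 0) (P1 0 v)) = p m *: v.
Hypothesis E_rho2 : forall m v, E2 0 (iter m (@rho _ _ P2 E2 0) (P2 0 v)) = p m *: v.

Hypothesis bv2_neq0 : bv2 0 [::] != 0.

Let P := sumP P1 P2.
Let E := sumE E1 E2.
Let K := sumK K1 K2.

Let rel : exchange_relations P E K.
Proof. by apply: sum_relations; [exact: exchange_relations_of_system es1 ea1 |
  exact: exchange_relations_of_system es2 ea2]. Qed.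

Let E_rho m v : E 0 (iter m (@rho _ _ P E 0) (P 0 v)) = p m *: v.
Proof.
suff Dit : iter m (@rho _ _ P E 0) (P 0 v) =
    (iter m (@rho _ _ P1 E1 0) (P1 0 v.1), iter m (@rho _ _ P2 E2 0) (P2 0 v.2)).
  by rewrite Dit; apply: injective_projections; rewrite /= ?E_rho1 ?E_rho2.
by elim: m => //= m ->.
Qed.

(* The graph of the intertwiner. *)
Definition linked j (u : V1 j) (v : V2 j) :=
  @generated _ _ P E K (bv1 0 [::], bv2 0 [::]) j (u, v).

Lemma to_front_color j n p0 y s : size p0 = n ->
  to_front K1 n (bv1 j (p0 ++ y :: s)) = bv1 j (y :: p0 ++ s).
Proof.
elim: n p0 y s => [|n IH] p0 y s; first by move/size0nil->.
case/lastP: p0 => // p0 x; rewrite size_rcons => -[np].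
rewrite cat_rcons /= (ea_K ea1) // c1E subr0 scale1r scale0r addr0 IH //.
by rewrite cat_rcons.
Qed.

Lemma rho_color j y s : y \notin s -> uniq s ->
  rho P1 E1 (bv1 j.+1 (y :: s)) = w1 y *: bv1 j.+1 (rcons s y).
Proof.
move=> ys us; rewrite /rho (ea_E ea1) // linearZ /= (E_P_bv es1 ea1) // -scalerBr.
rewrite (ea_P ea1) -sumrB (bigD1 y) //= big1 ?addr0 => [|z zy].
  by rewrite !a1E ys mem_head scale0r subr0 scale1r.
by rewrite !a1E inE negb_or zy subrr.
Qed.

(** Interpolation splits u into parts with a fixed first colour, and each part is still linked to 0.
    Forgetting the first colour of a part gives a vector of V_(j-1) linked to 0, hence zero by
    induction, and [cons1] recovers the part from this vector up to a nonzero weight. *)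
Lemma separation j (u : V1 j) : linked u 0 -> u = 0.
Proof.
elim: j u => [|j IH] u.
  case=> k; rewrite /= => -[-> /eqP]; rewrite eq_sym scaler_eq0 (negPf bv2_neq0) orbF.
  by move/eqP->; rewrite scale0r.
move=> gu.
(* [rho] moves the first colour to the end, with its weight, and [to_front] brings it back. Each b_s
   is thus an eigenvector for the weight of its first colour. *)
pose X1L : {linear _ -> _} := to_front K1 (j := j.+1) j \o @rho _ _ P1 E1 j.
pose XL : {linear _ -> _} := to_front K (j := j.+1) j \o @rho _ _ P E j.
have X1_bv y s : uniq (y :: s) -> size s = j ->
    X1L (bv1 j.+1 (y :: s)) = w1 y *: bv1 j.+1 (y :: s).
  case/andP=> ys us js; rewrite /X1L /= rho_color // linearZ /= -cats1.
  by rewrite to_front_color // cats0.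
have int_bv y z s : uniq (z :: s) -> size s = j ->
    interp w1 X1L y (bv1 j.+1 (z :: s)) = (z == y)%:R *: bv1 j.+1 (z :: s).
  by move=> us js; apply: interp_eigen; rewrite ?X1_bv.
have int0 y : interp w1 X1L y u = 0.
  have consE : cons1 y j \o (E1 j \o interp w1 X1L y) =1 w1 y \*: interp w1 X1L y.
    apply: (ea_ext ea1) => [||[//|z s] us [js]]; [exact: linearP.. |].
    rewrite /= int_bv // !linearZ /= (ea_E ea1); last by case/andP: us.
    rewrite linearZ /= cons1E scalerA; case: eqP => [->|_].
      by rewrite mul1r scale1r.
    by rewrite !(scale0r, scaler0, mul0r).
  suff E0 : E1 j (interp w1 X1L y u) = 0.
    have := consE u; rewrite /= E0 linear0 => /esym/eqP.
    by rewrite scaler_eq0 (negPf (w1_neq0 y)) => /eqP.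
  apply: IH; suff DE : (E1 j (interp w1 X1L y u), 0) = E j (interp w1 XL y (u, 0)).
    rewrite /linked DE; apply: (generated_E rel E_rho).
    apply: (@interp_closed _ _ w1 _ XL
      (@generated _ _ P E K (bv1 0 [::], bv2 0 [::]) j.+1)) => //.
    - by move=> v gv; apply: (generated_to_front rel) => //; exact: (generated_rho rel).
    - by move=> k v; apply: generated_scale.
    - by move=> v v'; apply: generated_add.
  pose X2L : {linear _ -> _} := to_front K2 (j := j.+1) j \o @rho _ _ P2 E2 j.
  have -> : interp w1 XL y (u, 0) = (interp w1 X1L y u, interp w1 X2L y 0).
    rewrite /interp; elim: [seq _ <- _ | _] => //= z s ->.
    by rewrite /XL /X1L /X2L /= sum_to_front.
  by rewrite linear0 /E /sumE /= /pair_map /= linear0.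
rewrite -[u]/(idfun u) (_ : idfun u = \sum_y interp w1 X1L y u).
  by rewrite big1.
apply: (ea_ext ea1 (f := idfun) (g := fun u => \sum_y interp w1 X1L y u)).
- by [].
- by move=> k x y; rewrite scaler_sumr -big_split; apply: eq_bigr => z _; rewrite linearP.
case=> // y s us [js]; rewrite (bigD1 y) //= int_bv // eqxx scale1r big1 ?addr0 // => z /negPf zy.
by rewrite int_bv // eq_sym zy scale0r.
Qed.

(** P b_s is the sum over all ways to append a new colour, and these terms have different
    eigenvalues under X. Interpolating at y isolates the term of y, and the same interpolation of
    the pair stays among the generated vectors. *)
Lemma linked_exists s : uniq s -> exists v, linked (bv1 (size s) s) v.
Proof.
elim/last_ind: s => [_|s y IH us].
  by exists (bv2 0 [::]), 1; rewrite scale1r.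
move: (us); rewrite rcons_uniq => /andP[ys us'].
have [v gv] := IH us'; set j := size s in v gv *; rewrite size_rcons -/j.
pose X1L : {linear _ -> _} := lastX P1 E1 K1 (j := j).
pose XL : {linear _ -> _} := lastX P E K (j := j).
exists (interp w1 XL y (P j (bv1 j s, v))).2.
have : @generated _ _ P E K (bv1 0 [::], bv2 0 [::]) j.+1 (interp w1 XL y (P j (bv1 j s, v))).
  apply: interp_closed.
  - by move=> u gu; apply: generated_lastX.
  - by move=> k u; apply: generated_scale.
  - by move=> u u'; apply: generated_add.
  - exact: generated_P.
rewrite /linked (_ : bv1 _ _ = (interp w1 XL y (P j (bv1 j s, v))).1).
  by rewrite -surjective_pairing.
have -> : (interp w1 XL y (P j (bv1 j s, v))).1 = interp w1 X1L y (P1 j (bv1 j s)).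
  rewrite /interp; elim: [seq _ <- _ | _] => //= z r <-.
  by rewrite /XL /X1L /= /lastX sum_to_front.
have lastX_bv z : z \notin s ->
    interp w1 X1L y (bv1 j.+1 (rcons s z)) = (z == y)%:R *: bv1 j.+1 (rcons s z).
  move=> zs; apply: interp_eigen => //.
  by rewrite /X1L /= /lastX -cats1 to_front_color // cats0 rho_color // cats1.
rewrite (ea_P ea1) linear_sum (bigD1 y) //= big1 ?addr0 => [|z zy].
  by rewrite linearZ /= lastX_bv // a1E ys eqxx !scale1r.
rewrite linearZ /= a1E; have [zs|zs] := boolP (z \in s); first by rewrite scale0r.
by rewrite lastX_bv // (negPf zy) scale0r scaler0.
Qed.

Lemma linked_P j u v : linked u v -> linked (P1 j u) (P2 j v).
Proof. exact: generated_P. Qed.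

Lemma linked_E j u v : linked u v -> linked (E1 j u) (E2 j v).
Proof. exact: (generated_E rel E_rho). Qed.

Lemma linked_add j u v u' v' : @linked j u v -> linked u' v' -> linked (u + u') (v + v').
Proof. exact: generated_add. Qed.

Lemma linked_scale j k u v : @linked j u v -> linked (k *: u) (k *: v).
Proof. exact: generated_scale. Qed.

End Comparison.

(** * Matrices *)

Lemma mxtrace_similar (F : fieldType) n (S A B : 'M[F]_n) :
  S \in unitmx -> S *m A = B *m S -> \tr A = \tr B.
Proof.
move=> uS SA; have -> : A = invmx S *m (B *m S) by rewrite -SA mulKmx.
by rewrite mxtrace_mulC mulmxK.
Qed.

Section Basis.

Variable N : nat.
Notation F := (ratfun N).
Implicit Types (j : nat) (s : seq 'I_N).

Definition tuple_of j (i : 'I_(dimV N j)) : seq 'I_N := val (enum_val i).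

Lemma tuple_of_uniq j (i : 'I_(dimV N j)) : uniq (tuple_of i).
Proof. exact: valP (enum_val i). Qed.

Lemma size_tuple_of j (i : 'I_(dimV N j)) : size (tuple_of i) = j.
Proof. exact: size_tuple. Qed.

Lemma tuple_of_inj j : injective (@tuple_of j).
Proof. by move=> i i' /val_inj/val_inj/enum_val_inj. Qed.

Lemma tuple_ofP j s : uniq s -> size s = j -> exists i : 'I_(dimV N j), tuple_of i = s.
Proof.
move=> us /eqP js.
exists (enum_rank (exist _ (Tuple js) us : injtuple N j)).
by rewrite /tuple_of enum_rankK.
Qed.

Lemma bvec_tuple_of j (i : 'I_(dimV N j)) : bvec j (tuple_of i) = delta_mx i 0.
Proof.
apply/colP => k; rewrite !mxE eqxx andbT.
by rewrite -/(tuple_of k) (inj_eq (@tuple_of_inj j)).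
Qed.

Lemma bvec0 j s : ~~ (uniq s && (size s == j)) -> bvec j s = 0.
Proof.
move=> s_bad; apply/colP => k; rewrite !mxE -/(tuple_of k).
case: eqP => // Ds; case/negP: s_bad.
by rewrite -Ds tuple_of_uniq size_tuple_of eqxx.
Qed.

Lemma bvec_not_uniq j s : ~~ uniq s -> bvec j s = 0.
Proof. by move=> /negPf us; rewrite bvec0 // us. Qed.

Lemma lin_of_basisE j j' (f : seq 'I_N -> 'cV[F]_(dimV N j')) s :
  uniq s -> size s = j -> lin_of_basis j f *m bvec j s = f s.
Proof.
move=> us js; have [i <-] := tuple_ofP us js.
rewrite bvec_tuple_of -colE; apply/colP => k.
by rewrite !mxE.
Qed.

Lemma lin_of_basis_ext j j' (f : seq 'I_N -> 'cV[F]_(dimV N j')) s :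
  (~~ (uniq s && (size s == j)) -> f s = 0) -> lin_of_basis j f *m bvec j s = f s.
Proof.
case: (boolP (uniq s && _)) => [/andP[us /eqP js] _|s_bad ->//].
  exact: lin_of_basisE.
by rewrite bvec0 ?mulmx0.
Qed.

Lemma vec_decomp j (v : 'cV[F]_(dimV N j)) :
  v = \sum_i v i 0 *: bvec j (tuple_of i).
Proof.
apply/colP => k; rewrite summxE (bigD1 k) //= big1 ?addr0 => [|i /negPf ik].
  by rewrite bvec_tuple_of !mxE !eqxx mulr1.
by rewrite bvec_tuple_of !mxE eq_sym ik mulr0.
Qed.

Lemma mulmx_ext m n (A B : 'M[F]_(m, n)) :
  (forall u : 'cV[F]_n, A *m u = B *m u) -> A = B.
Proof.
move=> AB; apply/matrixP => i k; have /colP/(_ i) := AB (delta_mx k 0).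
by rewrite -!colE !mxE.
Qed.

Lemma linear_ext j (W : lmodType F) (f g : 'cV[F]_(dimV N j) -> W) :
  linear f -> linear g ->
  (forall s, uniq s -> size s = j -> f (bvec j s) = g (bvec j s)) -> f =1 g.
Proof.
move=> lf lg fg v; pose fL := GRing.isLinear.Build _ _ _ _ f lf.
pose gL := GRing.isLinear.Build _ _ _ _ g lg.
pose f' : {linear _ -> _} := HB.pack f fL; pose g' : {linear _ -> _} := HB.pack g gL.
rewrite -[f v]/(f' v) -[g v]/(g' v) (vec_decomp v) !linear_sum.
apply: eq_bigr => i _; rewrite !linearZ; congr (_ *: _).
by apply: fg; rewrite ?tuple_of_uniq ?size_tuple_of.
Qed.

End Basis.

Section Operators.

Variable N : nat.
Notation F := (ratfun N).
Variables (a : 'I_N -> seq 'I_N -> F) (w : 'I_N -> F) (c : 'I_N -> 'I_N -> F).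
Implicit Types (j : nat) (s : seq 'I_N).

Definition addM j : 'M[F]_(dimV N j.+1, dimV N j) :=
  lin_of_basis j (fun s => \sum_(y | y \notin s) a y s *: bvec j.+1 (rcons s y)).

Definition dropM j : 'M[F]_(dimV N j, dimV N j.+1) :=
  lin_of_basis j.+1 (fun s => if s is x :: s' then w x *: bvec j s' else 0).

Definition swapM j i : 'M[F]_(dimV N j) :=
  lin_of_basis j (fun s =>
    if drop i s is x :: y :: s' then
      (1 - c x y) *: bvec j (take i s ++ y :: x :: s') + c x y *: bvec j s
    else 0).

Definition consM (y : 'I_N) j : 'M[F]_(dimV N j.+1, dimV N j) :=
  lin_of_basis j (fun s => bvec j.+1 (y :: s)).

Lemma addM_bvec j s :
  addM j *m bvec j s = \sum_y a y s *: bvec j.+1 (rcons s y).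
Proof.
rewrite /addM lin_of_basis_ext => [|s_bad].
  rewrite [RHS](bigID [pred y | y \in s]) /= [X in _ = X + _]big1 ?add0r // => y sy.
  by rewrite bvec_not_uniq ?scaler0 // rcons_uniq sy.
rewrite big1 // => y _; rewrite bvec0 ?scaler0 //.
rewrite rcons_uniq size_rcons eqSS -andbA; apply: contra s_bad.
by case/andP.
Qed.

Lemma dropM_bvec j x s : x \notin s -> dropM j *m bvec j.+1 (x :: s) = w x *: bvec j s.
Proof.
move=> xs; rewrite /dropM lin_of_basis_ext // => s_bad.
by rewrite bvec0 ?scaler0 //; move: s_bad; rewrite /= xs eqSS.
Qed.

Lemma swapM_bvec j i p x y s : size p = i ->
  swapM j i *m bvec j (p ++ x :: y :: s) =
  (1 - c x y) *: bvec j (p ++ y :: x :: s) + c x y *: bvec j (p ++ x :: y :: s).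
Proof.
move=> <-; rewrite /swapM lin_of_basis_ext => [|s_bad];
  rewrite (drop_size_cat _ (erefl (size p))) (take_size_cat _ (erefl (size p))).
  reflexivity.
rewrite [bvec j (_ ++ x :: _)](bvec0 s_bad) bvec0 ?scaler0 ?addr0; first reflexivity.
move: s_bad; rewrite !size_cat (@perm_uniq _ _ (p ++ y :: x :: s)) //.
by rewrite perm_cat2l perm_swap.
Qed.

Lemma consM_bvec y j s : consM y j *m bvec j s = bvec j.+1 (y :: s).
Proof.
rewrite /consM lin_of_basis_ext => [|s_bad]; first reflexivity.
by rewrite bvec0 //= eqSS -andbA; apply: contra s_bad; case/andP.
Qed.

Definition colV j : lmodType F := 'cV[F]_(dimV N j).
Definition addL j : {linear colV j -> colV j.+1} := mulmx (addM j).
Definition dropL j : {linear colV j.+1 -> colV j} := mulmx (dropM j).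
Definition swapL j i : {linear colV j -> colV j} := mulmx (swapM j i).
Lemma matrix_action :
  exchange_action a w c (V := colV) (fun j s => bvec j s) addL dropL swapL.
Proof.
split.
- by move=> j s; apply: bvec_not_uniq.
- by move=> j i f g lf lg; apply: linear_ext.
- by move=> j s; apply: addM_bvec.
- by move=> j x s; apply: dropM_bvec.
- by move=> j i p x y s; apply: swapM_bvec.
Qed.

(** [forgetM] and [buildM] are [forget] and [build] for arbitrary coefficients, so that labels and
    colours are treated by the same arguments. *)
Fixpoint forgetM (r s : nat) : 'M[F]_(dimV N r, dimV N s) :=
  if r == s then conform_mx 0 (1%:M : 'M[F]_(dimV N s))
  else match s with
       | 0 => 0
       | s'.+1 => forgetM r s' *m dropM s'
       end.

Fixpoint buildM (k s : nat) (rs : seq nat) : 'M[F]_(dimV N k, dimV N s) :=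
  match rs with
  | [::] => forgetM k s
  | r :: rs' => buildM k r.+1 rs' *m (addM r *m forgetM r s)
  end.

End Operators.

Section Intertwine.

Variable N : nat.
Notation F := (ratfun N).
Variables (a1 a2 : 'I_N -> seq 'I_N -> F) (w1 w2 : 'I_N -> F).
Variable S : forall j, 'M[F]_(dimV N j).
Hypothesis S_add : forall j, S j.+1 *m addM a1 j = addM a2 j *m S j.
Hypothesis S_drop : forall j, S j *m dropM w1 j = dropM w2 j *m S j.+1.

Lemma intertwine_forget r s : S r *m forgetM w1 r s = forgetM w2 r s *m S s.
Proof.
elim: s => [|s IH] /=; case: eqP => [<-|_]; rewrite ?mulmx0 ?mul0mx //.
- by rewrite !conform_mx_id mulmx1 mul1mx.
- by rewrite !conform_mx_id mulmx1 mul1mx.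
by rewrite mulmxA IH -!mulmxA S_drop.
Qed.

Lemma intertwine_build k s rs : S k *m buildM a1 w1 k s rs = buildM a2 w2 k s rs *m S s.
Proof.
elim: rs s => [|r rs IH] s /=; first exact: intertwine_forget.
by rewrite mulmxA IH -!mulmxA [S r.+1 *m _]mulmxA S_add -!mulmxA intertwine_forget.
Qed.

End Intertwine.

Section TraceComparison.

Variable N : nat.
Notation F := (ratfun N).
Variables (a1 a2 : 'I_N -> seq 'I_N -> F) (w1 w2 : 'I_N -> F) (c1 c2 : 'I_N -> 'I_N -> F).
Hypotheses (es1 : exchange_system a1 c1) (es2 : exchange_system a2 c2).
Hypothesis a1E : forall y s, a1 y s = (y \notin s)%:R.
Hypothesis c1E : forall y z, c1 y z = 0.
Hypothesis w1_inj : injective w1.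
Hypothesis w1_neq0 : forall y, w1 y != 0.
Variable p : nat -> F.
Hypothesis E_rho1 : forall m v,
  dropL w1 0 (iter m (@rho _ _ (addL a1) (dropL w1) 0) (addL a1 0 v)) = p m *: v.
Hypothesis E_rho2 : forall m v,
  dropL w2 0 (iter m (@rho _ _ (addL a2) (dropL w2) 0) (addL a2 0 v)) = p m *: v.

Let ea1 := matrix_action a1 w1 c1.
Let ea2 := matrix_action a2 w2 c2.

Let link j (u v : 'cV[F]_(dimV N j)) :=
  linked (fun j s => bvec j s : colV N j) (fun j s => bvec j s : colV N j)
    (addL a1) (addL a2) (dropL w1) (dropL w2) (swapL c1) (swapL c2)
    (u : colV N j) (v : colV N j).

Lemma bvec_nil_neq0 : bvec 0 [::] != 0 :> colV N 0.
Proof.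
have [i <-] := @tuple_ofP N 0 [::] isT erefl; rewrite bvec_tuple_of.
by apply/eqP => /matrixP/(_ i 0)/eqP; rewrite !mxE !eqxx oner_eq0.
Qed.

Let link0 j u : @link j u 0 -> u = 0.
Proof.
apply: (separation es1 es2 ea1 ea2 a1E c1E w1_inj w1_neq0 _ E_rho1 E_rho2).
  by move=> y i s; apply: (consM_bvec y).
exact: bvec_nil_neq0.
Qed.

Let link_mx j : exists S : 'M[F]_(dimV N j), forall u, link u (S *m u).
Proof.
have /fin_all_exists[v gv] (i : 'I_(dimV N j)) : exists v, link (bvec j (tuple_of i)) v.
  have := linked_exists (fun j s => bvec j s : colV N j) (addL a2) (dropL w2)
    (swapL c2) es1 ea1 a1E c1E w1_inj (tuple_of_uniq i).
  rewrite size_tuple_of; apply.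
pose S := \matrix_(k, i) v i k 0; exists S => u.
rewrite (vec_decomp u) mulmx_sumr; apply: (big_ind2 (@link j)).
- exact: generated0.
- by move=> x1 x2 y1 y2; apply: linked_add.
move=> i _; rewrite -scalemxAr; apply: linked_scale.
suff -> : S *m bvec j (tuple_of i) = v i by apply: gv.
by rewrite bvec_tuple_of -colE; apply/colP => k; rewrite !mxE.
Qed.

Let S j := projT1 (cid (link_mx j)).
Let linkS j u : link u (S j *m u). Proof. exact: (projT2 (cid (link_mx j))). Qed.

(** A vector in the kernel of S is linked to 0, so [link0] applies. *)
Let S_unit j : S j \in unitmx.
Proof.
rewrite -unitmx_tr -row_free_unit; apply/inj_row_free => u uS.
apply/trmx_inj; rewrite trmx0; apply: link0.
suff -> : 0 = S j *m u^T :> 'cV_ _ by apply: linkS.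
by apply/trmx_inj; rewrite trmx_mul trmxK uS trmx0.
Qed.

(** [link0] only controls first components linked to 0. Invertibility of S turns this around: v is S
    u' for some u', and u - u' is linked to 0. *)
Let link_fun j (u : 'cV[F]_(dimV N j)) v : link u v -> v = S j *m u.
Proof.
move=> uv; set u' := invmx (S j) *m v.
have Dv : v = S j *m u' by rewrite mulKVmx ?S_unit.
suff /eqP : u - u' = 0 by rewrite subr_eq0 => /eqP->.
apply: link0; rewrite -(subrr v) -!scaleN1r; apply: linked_add => //.
by apply: linked_scale; rewrite Dv; apply: linkS.
Qed.

(** That P and E preserve the graph of S means that S intertwines them, so the two words are similar
    matrices. *)
Lemma trace_buildM k rs : \tr (buildM a1 w1 k k rs) = \tr (buildM a2 w2 k k rs).
Proof.
have S_add j : S j.+1 *m addM a1 j = addM a2 j *m S j.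
  apply: mulmx_ext => u; rewrite -mulmxA; apply/esym/link_fun.
  by rewrite -mulmxA; exact: (linked_P (linkS u)).
have S_drop j : S j *m dropM w1 j = dropM w2 j *m S j.+1.
  apply: mulmx_ext => u; rewrite -mulmxA; apply/esym/link_fun.
  by rewrite -mulmxA; exact: (linked_E es1 es2 ea1 ea2 E_rho1 E_rho2 (linkS u)).
exact: mxtrace_similar (S_unit k) (intertwine_build S_add S_drop k k rs).
Qed.

End TraceComparison.

(** * The coefficients A *)

Section Coefficients.

Implicit Types (x y z b : nat) (s : seq nat).

Lemma natr_sub_neq0 x y : x != y -> x%:R - y%:R != 0 :> rat.
Proof. by rewrite subr_eq0 eqr_nat. Qed.

Lemma natr_sub1_neq0 x y : x != y.+1 -> x%:R - 1 - y%:R != 0 :> rat.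
Proof. by move=> xy; rewrite -addrA -opprD nat1r natr_sub_neq0. Qed.

Lemma Acoef_perm y s s' : perm_eq s s' -> Acoef y s = Acoef y s'.
Proof.
by move=> ss'; rewrite /Acoef /= (perm_mem ss') !(perm_big _ ss').
Qed.

Lemma Acoef_new b s : (0 < b)%N -> b \notin s -> Acoef b.+1 s = 0.
Proof. by case: b => // b _ /negPf bs; rewrite /Acoef /= bs. Qed.

Lemma Acoef_mem y s : 0%N \notin s -> y \in s -> Acoef y s = 0.
Proof.
move=> s0 sy; rewrite /Acoef; case: eqP => [y1|_].
  by rewrite (big_rem y) //= y1 subrr !mul0r.
case: ifP => // sb; have y_gt0 : (0 < y)%N by rewrite lt0n; apply: contraNneq s0 => <-.
rewrite (big_rem y) //= (_ : y != y.-1); last by apply/eqP; lia.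
by rewrite -(prednK y_gt0) /= -natr1 opprD addrA subrr add0r addNr !mul0r mulr0.
Qed.

(** Both clauses of [Acoef] obey one rule: for y = 1 the factor (1 - b) / (- b) is (b - 1) / b, and
    otherwise it is the factor of b in the product at y - 1. The excluded value y = b + 1 makes the
    denominator 0 and forces the case distinctions below. *)
Lemma Acoef_cons y b s : uniq (b :: s) -> 0%N \notin b :: s -> (0 < y)%N ->
  y != b.+1 -> Acoef y (b :: s) = (y%:R - b%:R) / (y%:R - 1 - b%:R) * Acoef y s.
Proof.
rewrite inE negb_or eq_sym -lt0n => /andP[bs us] /andP[b_gt0 s0] y_gt0 yb.
have b_neq0 : b%:R != 0 :> rat by rewrite pnatr_eq0 -lt0n.
rewrite /Acoef; case: eqP => [->|/eqP y1].
  by rewrite big_cons; congr (_ * _); field.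
have y'b : (y.-1 == b) = false by apply/negP => /eqP yb'; case/eqP: yb; lia.
rewrite in_cons y'b /=; case: ifP => // sy; last by rewrite mulr0.
have Dy : y%:R = y.-1%:R + 1 :> rat by rewrite natr1 prednK.
rewrite big_cons eq_sym y'b /= mulrCA; congr (_ * _); congr (_ * _).
  by rewrite Dy addrAC.
by rewrite Dy addrK.
Qed.

(** Distinct integers differ by at least 1, so b - a + 1 is 0 or has the sign of b - a. *)
Lemma Acoef_ge0 y s : 0%N \notin s -> 0 <= Acoef y s.
Proof.
move=> s0; have pos b : b \in s -> 1 <= b%:R :> rat.
  by rewrite ler1n lt0n; apply: contraTneq => ->.
rewrite /Acoef; case: eqP => _.
  rewrite big_seq prodr_ge0 // => b /pos b1; apply: divr_ge0; lra.
case: ifP => // /pos b1; apply: mulr_ge0; first by apply: divr_ge0; lra.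
rewrite prodr_ge0 // => b; rewrite neq_ltn => /orP[] lt_b.
  have : b%:R + 1 <= y.-1%:R :> rat by rewrite natr1 ler_nat.
  by move=> h; apply: divr_ge0; lra.
have : y.-1%:R + 1 <= b%:R :> rat by rewrite natr1 ler_nat.
by move=> h; rewrite -mulrNN -invrN; apply: divr_ge0; lra.
Qed.

Definition label_coef x y : rat := - (x%:R - y%:R)^-1.

(** If y and z are consecutive, one of the factors 1 - c and 1 + c vanishes, and the other side is 0
    by [Acoef_new]. Otherwise [Acoef_cons] reduces the claim to an identity of rational
    functions. *)
Lemma Acoef_PP s y z : uniq s -> 0%N \notin s -> (0 < y)%N -> (0 < z)%N ->
  y != z -> y \notin s -> z \notin s ->
  (1 - label_coef y z) * (Acoef y s * Acoef z (y :: s)) =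
  (1 + label_coef y z) * (Acoef z s * Acoef y (z :: s)).
Proof.
move=> us s0 y0 z0 yz ys zs; have yz0 := natr_sub_neq0 yz.
have s0' b : (0 < b)%N -> 0%N \notin b :: s by rewrite inE negb_or; case: b.
have [->|zy1] := eqVneq z y.+1.
  rewrite (Acoef_new _ ys) // mul0r mulr0 /label_coef -natr1 opprD addrA subrr add0r.
  by rewrite invrN1 opprK subrr mul0r.
have [->|yz1] := eqVneq y z.+1.
  rewrite (Acoef_new _ zs) // mul0r mulr0 /label_coef -natr1 addrAC subrr add0r.
  by rewrite invr1 addrN mul0r.
rewrite !Acoef_cons /= ?ys ?zs ?s0' // /label_coef.
have := natr_sub1_neq0 zy1; have := natr_sub1_neq0 yz1 => h1 h2.
by field; rewrite yz0 h1 h2.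
Qed.

Lemma Acoef_PEE x y s z : uniq [:: x, y & s] -> 0%N \notin [:: x, y & s] ->
  (0 < z)%N -> z \notin s ->
  Acoef z s + Acoef z [:: x, y & s] =
  (1 + label_coef x y) * Acoef z (y :: s) + (1 - label_coef x y) * Acoef z (x :: s).
Proof.
rewrite /= !inE !negb_or ![0%N == _]eq_sym -!lt0n => /and3P[/andP[xy xs] ys us].
case/and3P=> x0 y0 s0 z0 zs.
have Ux : uniq (x :: s) by rewrite /= xs.
have Uy : uniq (y :: s) by rewrite /= ys.
have Uxy : uniq [:: x, y & s] by rewrite /= inE negb_or xy xs ys.
have Uyx : uniq [:: y, x & s] by rewrite /= inE negb_or eq_sym xy xs ys.
have Zx : 0%N \notin x :: s by rewrite inE negb_or eq_sym -lt0n x0.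
have Zy : 0%N \notin y :: s by rewrite inE negb_or eq_sym -lt0n y0.
have Zxy : 0%N \notin [:: x, y & s] by rewrite inE negb_or eq_sym -lt0n x0.
have Zyx : 0%N \notin [:: y, x & s] by rewrite inE negb_or eq_sym -lt0n y0.
have xy0 := natr_sub_neq0 xy; rewrite /label_coef.
have [Dz|zx] := eqVneq z x.+1.
  have zy : z != y.+1 by rewrite Dz eqSS.
  rewrite (Acoef_perm z (perm_swap x y s)) (Acoef_cons Uyx) //.
  rewrite (Acoef_cons Uy) // Dz (Acoef_new x0 xs) -natr1.
  by field.
have [Dz|zy] := eqVneq z y.+1.
  rewrite (Acoef_cons Uxy) // (Acoef_cons Ux) // Dz (Acoef_new y0 ys) -natr1.
  by field; rewrite xy0 addrK andbT -opprB oppr_eq0.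
rewrite (Acoef_cons Uxy) // (Acoef_cons Uy) // (Acoef_cons Ux) //.
have := natr_sub1_neq0 zx; have := natr_sub1_neq0 zy => h1 h2.
by field; rewrite xy0 h1 h2.
Qed.

Lemma Acoef_PPE x s y z : uniq (x :: s) -> 0%N \notin x :: s ->
  (0 < y)%N -> (0 < z)%N -> y != z -> y \notin s -> z \notin s ->
  Acoef y s * Acoef z (y :: s) + Acoef y (x :: s) * Acoef z [:: x, y & s] =
  (1 + label_coef y z) *
    (Acoef y (x :: s) * Acoef z (y :: s) + Acoef z (x :: s) * Acoef y (z :: s)).
Proof.
move=> Ux Zx y0 z0 yz ys zs; have [xs us] := andP Ux.
move: (Zx); rewrite inE negb_or eq_sym -lt0n => /andP[x0 s0].
have Ub b : b \notin s -> uniq (b :: s) by move=> bs; rewrite /= bs.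
have Zb b : (0 < b)%N -> 0%N \notin b :: s.
  by move=> b0; rewrite inE negb_or eq_sym -lt0n b0.
have Zb2 b b' : (0 < b)%N -> (0 < b')%N -> 0%N \notin [:: b, b' & s].
  by move=> b0 b0'; rewrite inE negb_or eq_sym -lt0n b0 Zb.
have Ub2 b b' : b != b' -> b \notin s -> b' \notin s -> uniq [:: b, b' & s].
  by move=> bb bs bs'; rewrite /= inE negb_or bb bs bs'.
have Ax : Acoef x (x :: s) = 0 by rewrite Acoef_mem ?mem_head.
have yz0 := natr_sub_neq0 yz; rewrite /label_coef.
have [Dy|yz1] := eqVneq y z.+1.
  have -> : 1 - (y%:R - z%:R)^-1 = 0 :> rat by rewrite Dy -natr1 [_ + 1]addrC addrK invr1 subrr.
  rewrite mul0r {1}Dy (Acoef_new z0 zs) mul0r add0r.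
  have [Dz|zx] := eqVneq z x.
    by rewrite (@Acoef_mem z) ?mulr0 ?Dz ?mem_head ?Zb2.
  by rewrite Dy (Acoef_new z0) ?mul0r // inE negb_or zx.
have [Dz|zy1] := eqVneq z y.+1.
  have -> : 1 - (y%:R - z%:R)^-1 = 2 :> rat.
    by rewrite Dz -natr1 opprD addrA subrr add0r invrN1 opprK.
  have [Dy|yx] := eqVneq y x.
    rewrite -Dy in Ax *; rewrite Ax !mul0r addr0 add0r.
    have zE : z%:R = y%:R + 1 :> rat by rewrite Dz natr1.
    rewrite (Acoef_cons (Ub z zs)) ?Zb // zE.
    have -> : y%:R - (y%:R + 1) = - 1 :> rat by rewrite opprD addrA subrr add0r.
    have -> : y%:R - 1 - (y%:R + 1) = - 2 :> rat by ring.
    by field.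
  rewrite {4}Dz (@Acoef_new y (x :: s)) ?inE ?negb_or ?yx // mul0r addr0.
  have [Dy|yx1] := eqVneq y x.+1.
    rewrite {1}Dy (Acoef_new x0 xs) mul0r add0r.
    rewrite (@Acoef_cons z x) ?Zb2 ?Ub2 // 1?eq_sym //; last by rewrite Dz Dy; apply/eqP; lia.
    have -> : z%:R = x%:R + 2 :> rat by rewrite Dz Dy -!natr1 -addrA.
    have -> : x%:R + 2 - x%:R = 2 :> rat by rewrite addrAC subrr add0r.
    have -> : x%:R + 2 - 1 - x%:R = 1 :> rat by ring.
    by field.
  have zx1 : z != x.+1 by rewrite Dz eqSS.
  rewrite (@Acoef_cons z x) ?Zb2 ?Ub2 // 1?eq_sym // (@Acoef_cons y x) //.
  have := natr_sub1_neq0 yx1; have := natr_sub1_neq0 zx1.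
  have zE : z%:R = y%:R + 1 :> rat by rewrite Dz natr1.
  by rewrite zE => h1 h2; field; rewrite h1 h2.
have h1 := natr_sub1_neq0 yz1; have h2 := natr_sub1_neq0 zy1.
have [Dy|yx1] := eqVneq y x.+1.
  have zx1 : z != x.+1 by rewrite -Dy eq_sym.
  rewrite [in Acoef y s]Dy (Acoef_new x0 xs) mul0r add0r.
  have [Dz|zx] := eqVneq z x.
    by case/eqP: yz1; rewrite Dy Dz.
  have xy : x != y by rewrite Dy neq_ltn ltnSn.
  rewrite (@Acoef_cons z x [:: y & s]) ?Zb2 ?Ub2 //.
  rewrite (@Acoef_cons y z s) ?Ub ?Zb // [in Acoef y s]Dy (Acoef_new x0 xs) !mulr0 addr0.
  have h3 := natr_sub1_neq0 zx1; have := yz0; have := h2; rewrite Dy -natr1 => h4 h5.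
  by field; rewrite h3 h5.
have [Dz|zx1] := eqVneq z x.+1.
  have yx : y != x by apply/eqP => Dy; case/eqP: zy1; rewrite Dz Dy.
  rewrite (@Acoef_cons z y s) ?Ub ?Zb // [in Acoef z s]Dz (Acoef_new x0 xs) !mulr0 add0r.
  rewrite (Acoef_perm z (perm_swap x y s)) (@Acoef_cons z y) ?Zb2 ?Ub2 //.
  rewrite (@Acoef_cons y x s) // (@Acoef_cons y z s) ?Ub ?Zb //.
  have h3 := natr_sub1_neq0 yx1; have := yz0; have := h1; have := h2; rewrite Dz -natr1 => h4 h5 h6.
  by field; rewrite h6 h5 h4.
have [Dy|yx] := eqVneq y x.
  rewrite -Dy in Ax *; rewrite Ax !mul0r addr0 add0r (@Acoef_cons y z s) ?Ub ?Zb //.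
  by field; rewrite h1 yz0.
have xy : x != y by rewrite eq_sym.
rewrite (@Acoef_cons z x) ?Zb2 ?Ub2 //.
rewrite (@Acoef_cons y x s) // (@Acoef_cons z x s) //.
rewrite (@Acoef_cons y z s) ?Ub ?Zb // (@Acoef_cons z y s) ?Ub ?Zb //.
have h3 := natr_sub1_neq0 yx1; have h4 := natr_sub1_neq0 zx1.
by field; rewrite h1 h2 h3 h4 yz0.
Qed.

End Coefficients.

(** * Elementary symmetric polynomials that avoid one variable *)

Section ElementarySymmetric.

Variable N : nat.
Implicit Types (x : 'I_N) (k : nat) (h : {set 'I_N}).

(** The k-th elementary symmetric polynomial in the variables other than that of x. *)
Definition mesym_avoid x k : {mpoly rat[N]} :=
  \sum_(h : {set 'I_N} | (#|h| == k) && (x \notin h)) \prod_(i in h) 'X_i.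

Lemma sum_mem_set x k :
  \sum_(h : {set 'I_N} | (#|h| == k.+1) && (x \in h)) \prod_(i in h) 'X_i =
  'X_x * mesym_avoid x k :> {mpoly rat[N]}.
Proof.
rewrite /mesym_avoid mulr_sumr (reindex_onto (fun h => x |: h) (fun h => h :\ x)) /=.
  apply: eq_big => h.
    rewrite setU11 andbT; have [xh|xh] := boolP (x \in h).
      rewrite andbF; apply/negP => /andP[_ /eqP Dh].
      by move: xh; rewrite -Dh !inE eqxx.
    by rewrite cardsU1 xh eqSS setU1K // eqxx !andbT.
  case/andP=> /andP[/eqP ch _] /eqP Dh; have xh : x \notin h.
    by rewrite -Dh !inE eqxx.
  by rewrite big_setU1.
by move=> h /andP[_ xh]; rewrite setD1K.
Qed.

Lemma mesym_split x k :
  mesym N rat k.+1 = mesym_avoid x k.+1 + 'X_x * mesym_avoid x k.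
Proof.
rewrite -sum_mem_set addrC /mesym /mesym_avoid (bigID (fun h => x \in h)) /=.
by congr (_ + _).
Qed.

Lemma mesym_avoid0 x : mesym_avoid x 0 = 1.
Proof.
rewrite /mesym_avoid (bigD1 set0) /=; last by rewrite cards0 inE.
rewrite big_set0 big1 ?addr0 // => h /andP[/andP[]]; rewrite cards_eq0 => /eqP->.
by rewrite eqxx.
Qed.

Lemma mesym_avoid_full x k : (N <= k)%N -> mesym_avoid x k = 0.
Proof.
move=> Nk; rewrite /mesym_avoid big1 // => h /andP[/eqP ch xh].
have := subset_leq_card (subsetT (x |: h)).
by rewrite cardsU1 xh ch cardsT card_ord ltnNge Nk.
Qed.

(** Each set of k + 1 variables is counted once for each of its elements. *)
Lemma sum_mesym_avoid k :
  \sum_x 'X_x * mesym_avoid x k = k.+1%:R * mesym N rat k.+1.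
Proof.
under eq_bigr do rewrite -sum_mem_set big_mkcondr.
rewrite exchange_big /= /mesym mulr_sumr; apply: eq_bigr => h /eqP ch.
by rewrite -big_mkcond /= sumr_const ch mulr_natl.
Qed.

End ElementarySymmetric.

(** * The exchange systems of colours and of labels *)

Section Systems.

Variable N : nat.
Notation F := (ratfun N).
Implicit Types (x y z : 'I_N) (s : seq 'I_N).

Definition to_frac : {rmorphism {mpoly rat[N]} -> F} := @tofrac {mpoly rat[N]}.
Definition rat_to_frac : {rmorphism rat -> F} := to_frac \o @mpolyC N rat.

Lemma to_frac_eq0 p : (to_frac p == 0) = (p == 0).
Proof. exact: tofrac_eq0. Qed.

Lemma to_frac_inj : injective to_frac.
Proof. by move=> p q /eqP; rewrite /to_frac /= tofrac_eq => /eqP. Qed.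

Lemma natF_neq0 k : (0 < k)%N -> k%:R != 0 :> F.
Proof.
by move=> k0; rewrite -(rmorph_nat rat_to_frac) fmorph_eq0 pnatr_eq0 -lt0n.
Qed.

Definition color_a y s : F := (y \notin s)%:R.
Definition color_c x y : F := 0.
Definition color_w x : F := to_frac 'X_x.

(* With these two functions addM and dropM are convertible to Mop and Dop. *)
Definition label_a y s : F := (tofrac (Acoef y.+1 (colors s))%:MP : ratfun N).
Definition label_c x y : F := rat_to_frac (label_coef x.+1 y.+1).
Definition label_w (x : 'I_N) : F :=
  (tofrac (mesym N rat x.+1) / tofrac (mesym N rat x) : ratfun N).

Lemma label_aE y s : label_a y s = rat_to_frac (Acoef y.+1 (colors s)).
Proof. by []. Qed.

Lemma colors_uniq s : uniq (colors s) = uniq s.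
Proof. by rewrite map_inj_uniq // => x y [/val_inj]. Qed.

Lemma colors_mem x s : (x.+1 \in colors s) = (x \in s).
Proof. by rewrite (mem_map (f := fun c : 'I_N => c.+1)) // => y z [/val_inj]. Qed.

Lemma colors_pos s : 0%N \notin colors s.
Proof. by apply/mapP => -[]. Qed.

Lemma color_system : exchange_system color_a color_c.
Proof.
split; rewrite /color_c /color_a.
- by move=> x y; rewrite oppr0.
- by move=> x y z _ _ _; rewrite !mul0r.
- by move=> y s s' ss'; rewrite (perm_mem ss').
- by move=> y s _ ->.
- move=> s y z us yz /[dup] ys -> /[dup] zs ->.
  by rewrite !inE !negb_or ys zs eq_sym yz subr0 addr0.
- move=> x s y z _ yz ys zs; rewrite !inE !negb_or ys zs (eq_sym z y) yz /= !andbT.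
  rewrite addr0 !mul1r !mulr1; have [yx|yx] := eqVneq y x; have [zx|zx] := eqVneq z x;
    rewrite /= ?mulr1 ?mulr0 ?mul1r ?mul0r ?addr0 ?add0r //.
  by case/eqP: yz; rewrite yx zx.
- move=> x y s z /and3P[]; rewrite inE negb_or => /andP[xy _] _ _ zs.
  rewrite !inE !negb_or zs subr0 addr0 !mul1r /= !andbT.
  have [zx|zx] := eqVneq z x; have [zy|zy] := eqVneq z y; rewrite /= ?addr0 ?add0r //.
  by case/eqP: xy; rewrite -zx -zy.
Qed.

Lemma label_system : exchange_system label_a label_c.
Proof.
have ord_neq x y : x != y -> x.+1 != y.+1 by [].
split; rewrite /label_c.
- move=> x y; rewrite -rmorphN; congr (rat_to_frac _); rewrite /label_coef.
  by rewrite opprK -invrN opprB.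
- move=> x y z /ord_neq/natr_sub_neq0 xy /ord_neq/natr_sub_neq0 yz /ord_neq/natr_sub_neq0 xz.
  rewrite -rmorphM -rmorphD -rmorphM; congr (rat_to_frac _); rewrite /label_coef.
  move: (x.+1%:R : rat) (y.+1%:R : rat) (z.+1%:R : rat) xy yz xz => X Y Z xy yz xz.
  by field; rewrite xy yz xz.
- move=> y s s' ss'; rewrite !label_aE (Acoef_perm _ (_ : perm_eq _ (colors s'))) //.
  exact: perm_map.
- move=> y s us sy; rewrite label_aE Acoef_mem ?rmorph0 ?colors_pos //.
  by rewrite colors_mem.
- move=> s y z us yz ys zs; rewrite !label_aE -(rmorph1 rat_to_frac).
  rewrite -rmorphB -rmorphD -!rmorphM; congr (rat_to_frac _).
  by apply: Acoef_PP; rewrite ?colors_uniq ?colors_pos ?colors_mem.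
- move=> x s y z us yz ys zs; rewrite !label_aE -(rmorph1 rat_to_frac).
  rewrite -!rmorphM -!rmorphD -rmorphM; congr (rat_to_frac _).
  by apply: Acoef_PPE; rewrite ?colors_mem //
    -[_.+1 :: _]/(colors (x :: s)) ?colors_uniq ?colors_pos.
- move=> x y s z us zs; rewrite !label_aE -(rmorph1 rat_to_frac).
  rewrite -rmorphB -!rmorphD -!rmorphM -rmorphD; congr (rat_to_frac _).
  by apply: Acoef_PEE; rewrite ?colors_mem //
    -[_.+1 :: _]/(colors [:: x, y & s]) ?colors_uniq ?colors_pos.
Qed.

End Systems.

Lemma transfer_coef_step (F : fieldType) (k : nat) (e e' d' d x : F) :
  k.+1%:R != 0 :> F -> k.+2%:R != 0 :> F -> e != 0 -> e' != 0 -> e' = d' + x * d ->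
  e' / e * (1 - (k%:R / k.+1%:R + k.+2%:R / k.+1%:R * (d' / (k.+2%:R * e')))) =
  x * (d / (k.+1%:R * e)).
Proof.
rewrite -[k.+2]addn2 -[k.+1]addn1 !natrD => k1 k2 e0 e'0 De'.
have -> : d' = e' - x * d by rewrite De' addrK.
by field; rewrite e0 e'0 k1 k2.
Qed.

(** * The scalars E rho^m P on V_0 *)

Section VacuumMoments.

Variable N : nat.
Notation F := (ratfun N).
Implicit Types (x y z : 'I_N) (s : seq 'I_N).

(* The matrix of the intertwiner V_1 -> V_1 from labels to colours; k is the label
   minus 1. *)
Definition transfer_coef x (k : nat) : F :=
  to_frac N (mesym_avoid x k) / (k.+1%:R * to_frac N (mesym N rat k)).

Lemma transfer_coef0 x : transfer_coef x 0 = 1.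
Proof. by rewrite /transfer_coef mesym_avoid0 mesym0E rmorph1 mulr1 divr1. Qed.

Lemma to_frac_mesym_neq0 k : (k <= N)%N -> to_frac N (mesym N rat k) != 0.
Proof. by move=> kN; rewrite to_frac_eq0 mesym_neq0. Qed.

(** This compares the coefficients of b_x when the transfer matrix is exchanged with [rho]. With d_k
    for [mesym_avoid x k] it comes down to e_(k+1) = d_(k+1) + x d_k. *)
Lemma transfer_coefS x y :
  label_w y * (1 - (y%:R / y.+1%:R + y.+2%:R / y.+1%:R * transfer_coef x y.+1)) =
  color_w x * transfer_coef x y.
Proof.
apply: transfer_coef_step; rewrite ?natF_neq0 ?to_frac_mesym_neq0 // ?(ltnW (ltn_ord y)) //.
by rewrite (mesym_split x) rmorphD rmorphM.
Qed.

Lemma sum_transfer_coef y : \sum_x color_w x * transfer_coef x y = label_w y.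
Proof.
rewrite /transfer_coef /label_w; under eq_bigr do rewrite mulrA -rmorphM.
rewrite -mulr_suml -rmorph_sum sum_mesym_avoid rmorphM rmorph_nat invfM mulrACA.
by rewrite divff ?mul1r ?natF_neq0.
Qed.

(** The index k may lie outside the range of labels; the sum is then empty of contributions, and the
    hypothesis makes the right-hand side 0 too. *)
Lemma sum_eq_ord (k : nat) (g : nat -> F) : ((N <= k)%N -> g k = 0) ->
  \sum_(y : 'I_N) (y == k :> nat)%:R * g y = g k.
Proof.
move=> gk; have [kN|kN] := ltnP k N; last first.
  by rewrite gk // big1 // => y _; rewrite (ltn_eqF (leq_trans (ltn_ord y) kN)) mul0r.
rewrite (bigD1 (Ordinal kN)) //= eqxx mul1r big1 ?addr0 // => y yk.
by rewrite -val_eqE /= in yk; rewrite (negPf yk) mul0r.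
Qed.

Lemma label_a_nil y : label_a y [::] = (y == 0%N :> nat)%:R.
Proof.
rewrite label_aE /Acoef eqSS; case: eqP => _; last exact: rmorph0.
by rewrite big_nil rmorph1.
Qed.

Lemma label_a_seq1 y x : label_a y [:: x] =
  (y == 0%N :> nat)%:R * (x%:R / x.+1%:R) +
  (y == x.+1 :> nat)%:R * (x.+2%:R / x.+1%:R).
Proof.
rewrite label_aE; have -> : Acoef y.+1 (colors [:: x]) =
    (y == 0%N :> nat)%:R * (x%:R / x.+1%:R) + (y == x.+1 :> nat)%:R * (x.+2%:R / x.+1%:R).
  rewrite /Acoef eqSS; have [->|y0] := eqVneq (y : nat) 0%N.
    by rewrite /= big_seq1 -natr1 addrK natr1 mul1r mul0r addr0.
  rewrite /= inE mul0r add0r; case: eqP => [->|_]; last by rewrite mul0r.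
  by rewrite big_cons eqxx /= big_nil mulr1 natr1 mul1r.
by rewrite rmorphD !rmorphM !fmorphV !rmorph_nat.
Qed.

Let rhoC : {linear colV N 1 -> colV N 1} := @rho _ _ (addL (@color_a N)) (dropL (@color_w N)) 0.
Let rhoL : {linear colV N 1 -> colV N 1} := @rho _ _ (addL (@label_a N)) (dropL (@label_w N)) 0.

Definition transferM : 'M[F]_(dimV N 1) :=
  lin_of_basis 1 (fun s => if s is [:: y] then \sum_x transfer_coef x y *: bvec 1 [:: x] else 0).

Lemma transferM_bvec y :
  transferM *m bvec 1 [:: y] = \sum_x transfer_coef x y *: bvec 1 [:: x].
Proof. by rewrite /transferM lin_of_basisE. Qed.

Definition transferL : {linear colV N 1 -> colV N 1} := mulmx transferM.

Let actC := matrix_action (@color_a N) (@color_w N) (@color_c N).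
Let actL := matrix_action (@label_a N) (@label_w N) (@label_c N).

Lemma transfer_add v : transferL (addL (@label_a N) 0 v) = addL (@color_a N) 0 v.
Proof.
apply: (ea_ext actC (f := transferL \o addL (@label_a N) 0)
  (g := addL (@color_a N) 0)) v => [||s us /size0nil ->]; [exact: linearP..|].
rewrite /= (ea_P actL) (ea_P actC) linear_sum /=.
under eq_bigr => y _.
  rewrite linearZ /= [transferL _]transferM_bvec label_a_nil scaler_sumr.
  under eq_bigr do rewrite scalerA.
  over.
rewrite exchange_big; apply: eq_bigr => x _ /=.
rewrite -scaler_suml sum_eq_ord ?transfer_coef0 //.
by move=> N0; have := ltn_ord x; rewrite ltnNge (leq_trans N0).
Qed.

Lemma transfer_drop v : dropL (@color_w N) 0 (transferL v) = dropL (@label_w N) 0 v.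
Proof.
apply: (ea_ext actC (f := dropL (@color_w N) 0 \o transferL)
  (g := dropL (@label_w N) 0)) v => [||[//|y [|//]] us _]; [exact: linearP..|].
rewrite /= (ea_E actL) // [transferL _]transferM_bvec linear_sum /=.
under eq_bigr do rewrite linearZ /= (ea_E actC) // scalerA mulrC.
by rewrite -scaler_suml sum_transfer_coef.
Qed.

Lemma transfer_rho v : transferL (rhoL v) = rhoC (transferL v).
Proof.
apply: (ea_ext actC (f := transferL \o rhoL) (g := rhoC \o transferL)) v
  => [||[//|y [|//]] us _]; [exact: linearP..|].
rewrite /= [transferL (bvec _ _)]transferM_bvec linear_sum /=.
under [RHS]eq_bigr => x _.
  rewrite linearZ /= [rhoC _](rho_color (color_system N) actC) // scalerA mulrC.
  rewrite -transfer_coefS.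
  over.
rewrite /rhoL /rho (ea_E actL) // (E_P_bv (label_system N) actL) // linearZ /= -scalerBr.
rewrite (ea_P actL) -sumrB linearZ /= linear_sum /=.
under eq_bigr => z _.
  rewrite -scalerBl linearZ /= [transferL _]transferM_bvec scaler_sumr.
  under eq_bigr do rewrite scalerA.
  over.
rewrite exchange_big scaler_sumr; apply: eq_bigr => x _ /=.
rewrite -scaler_suml scalerA; congr (_ * _ *: _).
have N_gt0 : (N <= 0)%N -> False by move=> N0; have := ltn_ord x; rewrite ltnNge (leq_trans N0).
under eq_bigr do rewrite label_a_nil label_a_seq1 mulrBl mulrDl -!mulrA.
rewrite sumrB big_split /=; congr (_ - (_ + _)).
- by apply: etrans (sum_eq_ord (g := transfer_coef x) _) (transfer_coef0 x) => /N_gt0.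
- apply: etrans (sum_eq_ord (k := 0%N)
    (g := fun k => y%:R * (y.+1%:R^-1 * transfer_coef x k)) _) _ => [/N_gt0 //|].
  by rewrite transfer_coef0 mulr1.
- apply: etrans (sum_eq_ord (k := y.+1)
    (g := fun k => y.+2%:R * (y.+1%:R^-1 * transfer_coef x k)) _) _.
    (* The largest label has no successor among the labels; correspondingly, e_N in N - 1 variables
       is 0. *)
    by move=> Ny; rewrite /transfer_coef mesym_avoid_full // rmorph0 mul0r !mulr0.
  by rewrite mulrA.
Qed.

Definition moment m : F := \sum_x color_w x ^+ m.+1.

Lemma color_moment m v :
  dropL (@color_w N) 0 (iter m rhoC (addL (@color_a N) 0 v)) = moment m *: v.
Proof.
pose f m := dropL (@color_w N) 0 \o (iter m rhoC \o addL (@color_a N) 0).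
have lf : linear (f m).
  by move=> k u u'; rewrite /f /= linearP (linear_iter rhoC) linearP.
apply: (ea_ext actC (f := f m) (g := moment m \*: idfun)) v => [//||s us /size0nil ->].
  exact: linearP.
pose g : {linear colV N 1 -> colV N 0} := dropL (@color_w N) 0.
rewrite /f /= (ea_P actC) -/g.
have -> (h : 'I_N -> F) : iter m rhoC (\sum_x h x *: bvec 1 [:: x]) =
    \sum_x (h x * color_w x ^+ m) *: bvec 1 [:: x].
  elim: m {lf} => [|k IH]; first by apply: eq_bigr => x _; rewrite mulr1.
  rewrite iterS IH linear_sum; apply: eq_bigr => x _ /=.
  rewrite linearZ /= [rhoC _](rho_color (color_system N) actC) //.
  by rewrite scalerA exprSr mulrA.
rewrite linear_sum /moment scaler_suml; apply: eq_bigr => x _ /=.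
by rewrite linearZ /= /g (ea_E actC) // mul1r scalerA exprSr.
Qed.

(** The transfer matrix on V_1, together with the identity on V_0, intertwines P, [rho] and E, so
    the moments of labels are those of colours. *)
Lemma label_moment m v :
  dropL (@label_w N) 0 (iter m rhoL (addL (@label_a N) 0 v)) = moment m *: v.
Proof.
rewrite -transfer_drop -color_moment -transfer_add; congr (dropL _ _ _).
exact: (iter_comm m _ transfer_rho).
Qed.

Lemma trace_label_color k rs :
  \tr (buildM (@label_a N) (@label_w N) k k rs) = \tr (buildM (@color_a N) (@color_w N) k k rs).
Proof.
apply/esym/(trace_buildM (color_system N) (label_system N) _ _ _ _ color_moment label_moment) => //.
- move=> x y /to_frac_inj/(congr1 (fun p => p@_U_(y)%MM)).
  by rewrite !mcoeffXU eqxx => /eqP; rewrite eqr_nat; case: (x =P y).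
- move=> x; rewrite to_frac_eq0; apply/eqP => /(congr1 (fun p => p@_U_(x)%MM))/eqP.
  by rewrite mcoeffXU eqxx mcoeff0 oner_eq0.
Qed.

End VacuumMoments.

(** * Expansion of the trace *)

Section TupleSums.

Variables (V : nmodType) (T : finType).

Lemma sum_tuple_cons n (G : seq T -> V) :
  \sum_(t : n.+1.-tuple T) G t = \sum_y \sum_(t : n.-tuple T) G (y :: t).
Proof.
rewrite pair_big /= (reindex (fun p : T * n.-tuple T => [tuple of p.1 :: p.2])) //=.
exists (fun t => (thead t, [tuple of behead t])) => [[y t] _|t _] /=.
  by congr (_, _); apply: val_inj.
by rewrite -tuple_eta.
Qed.

Lemma sum_tuple_cat m n (G : seq T -> V) :
  \sum_(s : m.-tuple T) \sum_(t : n.-tuple T) G (s ++ t) = \sum_(g : (m + n).-tuple T) G g.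
Proof.
elim: m G => [|m IH] G; last first.
  rewrite (@sum_tuple_cons m (fun s => \sum_(t : n.-tuple T) G (s ++ t))).
  rewrite [RHS](@sum_tuple_cons (m + n) G); apply: eq_bigr => y _.
  exact: (IH (fun s => G (y :: s))).
by rewrite (big_pred1 [tuple]) // => t; rewrite [t]tuple0.
Qed.

(** A word of length n + k whose last k letters repeat the first k is determined by its first n
    letters. For the trace this is the gluing of the last k vertices to the first k. *)
Lemma sum_tuple_period k n (G : seq T -> V) : (k <= n)%N ->
  \sum_(s : k.-tuple T) \sum_(t : n.-tuple T | drop n (s ++ t) == s) G (s ++ t) =
  \sum_(t : n.-tuple T) G (t ++ take k t).
Proof.
move=> kn; under eq_bigr => s _.
  rewrite big_mkcond /=.
  under eq_bigr => t _ do rewrite -[X in _ == X](take_size_cat t (size_tuple s)).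
  over.
rewrite (@sum_tuple_cat k n (fun g => if drop n g == take k g then G g else 0)).
rewrite -big_mkcond /= addnC.
have szg (t : n.-tuple T) : size (t ++ take k t) == (n + k)%N.
  by rewrite size_cat size_takel size_tuple.
have szt (g : (n + k).-tuple T) : size (take n g) == n.
  by rewrite size_takel // size_tuple leq_addr.
rewrite (reindex_onto (fun t => Tuple (szg t)) (fun g => Tuple (szt g))) /=.
  apply: eq_bigl => t; rewrite drop_size_cat ?size_tuple // takel_cat ?size_tuple //.
  rewrite eqxx /=; apply/eqP; apply: val_inj.
  by rewrite /= take_size_cat ?size_tuple.
move=> g /eqP Dg; apply: val_inj; rewrite /= take_takel //.
by rewrite -Dg cat_take_drop.
Qed.

End TupleSums.

Section TraceExpansion.

Variable N : nat.
Notation F := (ratfun N).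
Variables (a : 'I_N -> seq 'I_N -> F) (w : 'I_N -> F).
Hypothesis a_mem : forall y s, uniq s -> y \in s -> a y s = 0.
Implicit Types (g h s : seq 'I_N) (rs : seq nat).

Definition marked r h := drop (size h - r) h.

Definition drop_weight r h : F := \prod_(x <- take (size h - r) h) w x.

Fixpoint admissible (k s : nat) rs : bool :=
  if rs is r :: rs' then (r <= s)%N && admissible k r.+1 rs' else (k <= s)%N.

Lemma size_marked r h : (r <= size h)%N -> size (marked r h) = r.
Proof. by move=> rh; rewrite size_drop subKn. Qed.

Lemma forgetM_bvec (r s : nat) h : (r <= s)%N -> uniq h -> size h = s ->
  forgetM w r s *m bvec s h = drop_weight r h *: bvec r (marked r h).
Proof.
rewrite /drop_weight /marked.
elim: s h => [|s IH] h; rewrite leq_eqVlt => /orP[/eqP -> us hs|].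
- by rewrite /= ?eqxx conform_mx_id mul1mx hs subnn take0 drop0 big_nil scale1r.
- by [].
- by rewrite /= ?eqxx conform_mx_id mul1mx hs subnn take0 drop0 big_nil scale1r.
rewrite ltnS => rs; case: h => // x h /andP[xh uh] [hs].
rewrite [forgetM _ _ _]/= (ltn_eqF (rs : (r < s.+1)%N)) -mulmxA dropM_bvec //.
rewrite -scalemxAr IH // scalerA /= hs subSn //= big_cons.
by [].
Qed.

Fixpoint run (W : lmodType F) h rs (fin : seq 'I_N -> W) : W :=
  if rs is r :: rs' then \sum_y a y (marked r h) *: run (rcons h y) rs' fin else fin h.

Lemma marked_marked (r s : nat) h : (r <= s <= size h)%N -> marked r (marked s h) = marked r h.
Proof.
move=> /andP[rs sh]; rewrite /marked drop_drop size_drop subKn // addnC.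
by congr drop; lia.
Qed.

Lemma marked_rcons r h y : marked r.+1 (rcons h y) = rcons (marked r h) y.
Proof. by rewrite /marked size_rcons subSS drop_rcons ?leq_subr. Qed.

Lemma drop_weight_rcons r h y : drop_weight r.+1 (rcons h y) = drop_weight r h.
Proof. by rewrite /drop_weight size_rcons subSS -cats1 takel_cat ?leq_subr. Qed.

Lemma drop_weight_marked (r s : nat) h : (r <= s <= size h)%N ->
  drop_weight s h * drop_weight r (marked s h) = drop_weight r h.
Proof.
move=> /andP[rs sh]; rewrite /drop_weight -big_cat /= size_marked // /marked.
have -> : (size h - r = (size h - s) + (s - r))%N by lia.
by rewrite takeD.
Qed.

(** The history [h] keeps the forgotten entries too, and [drop_weight] collects their weights.
    Appending a marked entry again has coefficient 0, so the marked entries stay distinct. *)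
Lemma buildM_run k h (s : nat) rs : admissible k s rs -> (s <= size h)%N -> uniq (marked s h) ->
  drop_weight s h *: (buildM a w k s rs *m bvec s (marked s h)) =
  run h rs (fun g => drop_weight k g *: bvec k (marked k g)).
Proof.
elim: rs h s => [|r rs IH] h s /= => [ks|/andP[rs_s adm]] sh us.
  by rewrite forgetM_bvec ?size_marked // scalerA drop_weight_marked ?ks // marked_marked ?ks.
rewrite -!mulmxA forgetM_bvec ?size_marked // -!scalemxAr scalerA drop_weight_marked ?rs_s //.
rewrite marked_marked ?rs_s // addM_bvec mulmx_sumr scaler_sumr; apply: eq_bigr => y _.
have ur : uniq (marked r h) by rewrite -(marked_marked (s := s)) ?rs_s // drop_uniq.
have [ry|ry] := boolP (y \in marked r h).
  by rewrite a_mem // !scale0r mulmx0 scaler0.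
rewrite -scalemxAr scalerA mulrC -scalerA -marked_rcons -(drop_weight_rcons r h y).
congr (_ *: _); apply: IH => //; first by rewrite size_rcons ltnS (leq_trans rs_s).
by rewrite marked_rcons rcons_uniq ry.
Qed.

Fixpoint step_weight h rs g : F :=
  if rs is r :: rs' then
    if g is y :: g' then a y (marked r h) * step_weight (rcons h y) rs' g' else 0
  else 1.

Lemma run_sum (W : lmodType F) h rs (fin : seq 'I_N -> W) :
  run h rs fin = \sum_(g : (size rs).-tuple 'I_N) step_weight h rs g *: fin (h ++ g).
Proof.
elim: rs h => [|r rs IH] h /=.
  by rewrite (big_pred1 [tuple]) ?scale1r ?cats0 // => t; rewrite [t]tuple0.
rewrite (sum_tuple_cons _ (fun g => (if g is y :: g' then
  a y (marked r h) * step_weight (rcons h y) rs g' else 0) *: fin (h ++ g))).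
apply: eq_bigr => y _; rewrite IH scaler_sumr; apply: eq_bigr => g _.
by rewrite scalerA cat_rcons.
Qed.

Lemma sum_tuple_of j (W : nmodType) (G : seq 'I_N -> W) :
  \sum_(i : 'I_(dimV N j)) G (tuple_of i) = \sum_(t : j.-tuple 'I_N | uniq t) G t.
Proof.
rewrite /tuple_of -(big_enum_val (A := predT) (fun s : injtuple N j => G (val s))) /=.
by rewrite -(big_sub [pred t : j.-tuple 'I_N | uniq t] (fun t => G (tval t))).
Qed.

(** [t ++ take k t] lists the entries at all vertices of G. In the course of the word exactly the
    first n of them, which form [t], are forgotten. *)
Definition path_weight k rs (t : seq 'I_N) : F :=
  step_weight (take k t) rs (drop k (t ++ take k t)) * \prod_(x <- t) w x.

Lemma trace_expansion n k rs : (k <= n)%N -> size rs = n -> admissible k k rs ->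
  \tr (buildM a w k k rs) = \sum_(t : n.-tuple 'I_N | uniq (take k t)) path_weight k rs t.
Proof.
move=> kn rsn adm; rewrite /mxtrace.
(* The boolean factor comes from reading a diagonal entry: the last k entries have to be [s]
   again. *)
pose G s := \sum_(g : n.-tuple 'I_N) step_weight s rs g *
   (drop_weight k (s ++ g) * (s == marked k (s ++ g))%:R).
transitivity (\sum_(i : 'I_(dimV N k)) G (tuple_of i)).
  apply: eq_bigr => i _.
  have ki : (k <= size (tuple_of i))%N by rewrite size_tuple_of.
  have mi : marked k (tuple_of i) = tuple_of i.
    by rewrite /marked size_tuple_of subnn drop0.
  have := buildM_run adm ki; rewrite mi => /(_ (tuple_of_uniq i)).
  rewrite {1}/drop_weight size_tuple_of subnn take0 big_nil scale1r run_sum rsn.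
  move/matrixP/(_ i 0); rewrite bvec_tuple_of -colE mxE => ->.
  rewrite summxE; apply: eq_bigr => g _.
  by rewrite !mxE.
rewrite sum_tuple_of big_mkcond /=.
pose H (g : seq 'I_N) := if uniq (take k g) then
  step_weight (take k g) rs (drop k g) * \prod_(x <- take n g) w x else 0.
transitivity (\sum_(s : k.-tuple 'I_N) \sum_(g : n.-tuple 'I_N | drop n (s ++ g) == s) H (s ++ g)).
  apply: eq_bigr => s _; rewrite /H /G.
  under [RHS]eq_bigr do rewrite take_size_cat ?size_tuple // drop_size_cat ?size_tuple //.
  case: ifP => us; last by rewrite big1.
  rewrite [RHS]big_mkcond; apply: eq_bigr => g _.
  rewrite /marked /drop_weight size_cat !size_tuple addKn eq_sym.
  by case: eqP => _; rewrite ?mulr0 ?mulr1.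
rewrite (sum_tuple_period _ kn) [RHS]big_mkcond; apply: eq_bigr => t _.
rewrite /H /path_weight takel_cat ?size_tuple // take_size_cat ?size_tuple //.
Qed.

End TraceExpansion.

Lemma card_ord_interval m (p q : nat) : (q <= m)%N ->
  #|[set i : 'I_m | (p <= i < q)%N]| = (q - p)%N.
Proof.
move=> qm; rewrite -sum1_card.
rewrite (eq_bigl (fun i : 'I_m => (p <= i < q)%N)) => [|i]; last by rewrite inE.
rewrite -(big_mkord (fun i => (p <= i < q)%N) (fun=> 1%N)).
rewrite -(big_nat_widen 0 q m (fun i => (p <= i)%N)) //.
rewrite -(big_nat_widenl p 0 q predT) // sum_nat_const_nat muln1 //.
Qed.

(** * Smaller neighbours in a natural unit interval graph *)

Section UnitIntervalGraph.

Variables (n k : nat) (G : rel 'I_(n + k)).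
Hypothesis le_kn : (k <= n)%N.
Hypothesis G_nui : natural_unit_interval G.
Hypothesis G_first : clique G [pred p : 'I_(n + k) | (p < k)%N].
Hypothesis G_last : clique G [pred p : 'I_(n + k) | (n <= p)%N].
Implicit Types (p q u v : 'I_(n + k)).

Definition lower_degree v := #|[set u : 'I_(n + k) | (u < v)%N && G u v]|.

Lemma G_sym p q : G p q = G q p.
Proof. by have [sG _ _] := G_nui. Qed.

Lemma G_between p (r : 'I_(n + k)) q : (p < r)%N -> (r < q)%N -> G p q -> G p r && G r q.
Proof. by have [_ _ nG] := G_nui; apply: nG. Qed.

(** The smaller neighbours of v form an interval that ends just below v, so their number determines
    them. *)
Lemma lower_neighbor u v : (u < v)%N -> G u v = (v - lower_degree v <= u)%N.
Proof.
move=> uv; have le_v : (v <= n + k)%N by apply: ltnW.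
have [Guv|nGuv] := boolP (G u v); apply/esym.
  rewrite leq_subCl /lower_degree -(card_ord_interval u le_v) subset_leq_card //.
  apply/subsetP => i; rewrite !inE => /andP[]; rewrite leq_eqVlt => /orP[/eqP ui|ui] iv.
    by rewrite (_ : i = u) ?uv //; apply/val_inj.
  by rewrite iv; have /andP[] := G_between ui iv Guv.
apply/negbTE; rewrite -ltnNge ltn_subRL.
have : (lower_degree v <= v - u.+1)%N; last by lia.
rewrite -(card_ord_interval u.+1 le_v) subset_leq_card //.
apply/subsetP => i; rewrite !inE => /andP[iv Giv]; rewrite iv andbT ltnNge.
apply: contra nGuv; rewrite leq_eqVlt => /orP[/eqP iu|iu].
  by rewrite (_ : u = i) //; apply/val_inj.
by have /andP[] := G_between iu uv Giv.
Qed.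

Lemma lower_degree_le v : (lower_degree v <= v)%N.
Proof.
have le_v : (v <= n + k)%N by apply: ltnW.
rewrite -[leqRHS]subn0 -(card_ord_interval 0 le_v) subset_leq_card //.
by apply/subsetP => i; rewrite !inE => /andP[].
Qed.

(** The lowest neighbour of v, if it lies below u, is adjacent to u by the interval property. *)
Lemma lower_degreeS u v : v = u.+1 :> nat -> (lower_degree v <= (lower_degree u).+1)%N.
Proof.
move=> vu; have dv := lower_degree_le v; have du := lower_degree_le u.
have [//|d1] := leqP (lower_degree v) 1; first by move=> d1; apply: leq_trans d1 _.
have lt_p : (v - lower_degree v < n + k)%N by apply: leq_ltn_trans (leq_subr _ _) (ltn_ord v).
pose p := Ordinal lt_p; have pu : (p < u)%N by rewrite /p /=; lia.
have Gpv : G p v by rewrite lower_neighbor //= ; lia.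
have uv : (u < v)%N by rewrite vu.
have /andP[] := G_between pu uv Gpv; rewrite lower_neighbor //= => H _.
by lia.
Qed.

Definition lower_degrees : seq nat :=
  [seq #|[set u : 'I_(n + k) | (u < v)%N && G u v]|
            | v : 'I_(n + k) <- enum 'I_(n + k) & (k <= v)%N].

Let D i := oapp lower_degree 0%N (insub i).

Lemma lower_degrees_iota : lower_degrees = [seq D i | i <- iota k n].
Proof.
have -> : iota k n = [seq i <- iota 0 (n + k) | (k <= i)%N].
  rewrite addnC iotaD filter_cat (eq_in_filter (a2 := pred0)) ?filter_pred0 /=; last first.
    by move=> i; rewrite mem_iota add0n => /andP[_ ik]; rewrite leqNgt ik.
  by rewrite add0n; apply/esym/all_filterP/allP => i; rewrite mem_iota => /andP[].
rewrite -val_enum_ord filter_map -map_comp; apply: eq_map => v /=.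
by rewrite /D valK.
Qed.

Lemma admissible_iota s m j :
  (j = 0%N -> (k <= s)%N) -> ((0 < j)%N -> (D m <= s)%N) ->
  (forall i, (m <= i)%N -> (i.+1 < m + j)%N -> (D i.+1 <= (D i).+1)%N) ->
  ((0 < j)%N -> (k <= (D (m + j).-1).+1)%N) ->
  admissible k s [seq D i | i <- iota m j].
Proof.
elim: j s m => [|j IH] s m ks Dm Ds Dl /=; first exact: ks.
rewrite Dm //=; apply: IH => [j0|j0|i mi ij|j0].
- by have := Dl isT; rewrite j0 addn1.
- by apply: Ds => //; lia.
- by apply: Ds; lia.
- by have := Dl isT; rewrite addSnnS.
Qed.

Lemma lower_degrees_admissible : admissible k k lower_degrees.
Proof.
rewrite lower_degrees_iota; apply: admissible_iota => //.
- move=> n0; have lt_k : (k < n + k)%N by lia.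
  by rewrite /D insubT /=; apply: lower_degree_le.
- move=> i ki ik; have lt_i : (i < n + k)%N by lia.
  have lt_i1 : (i.+1 < n + k)%N by lia.
  by rewrite /D !insubT /=; apply: lower_degreeS.
move=> n0; have lt_l : ((k + n).-1 < n + k)%N by lia.
rewrite /D insubT /=; set v : 'I_(n + k) := Sub _ _.
(* The final forgetting down to k marks is possible because the last vertex is adjacent to the k - 1
   vertices before it, all in the final clique; adjacency to the lowest of these suffices. *)
have [k1|k1] := leqP k 1; first by apply: leq_trans k1 _.
have lt_n : (n < n + k)%N by lia.
pose u := Ordinal lt_n; have uv : (u < v)%N by rewrite /=; lia.
have : G u v.
  apply: G_last; rewrite ?inE /=; first by []; first by lia.
  by apply/eqP => /(congr1 val) /=; lia.
by rewrite lower_neighbor //=; lia.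
Qed.

Lemma size_lower_degrees : size lower_degrees = n.
Proof. by rewrite lower_degrees_iota size_map size_iota. Qed.

Lemma nth_lower_degrees (v : 'I_(n + k)) : (k <= v)%N ->
  nth 0%N lower_degrees (v - k) = lower_degree v.
Proof.
move=> kv; have lt_v : (v - k < n)%N by have := ltn_ord v; lia.
rewrite lower_degrees_iota (nth_map 0%N) ?size_iota // nth_iota // subnKC //.
by rewrite /D valK.
Qed.

Section Labellings.

Variable T : eqType.
Implicit Types (t : n.-tuple T).

Fact size_period t : size (t ++ take k t) == (n + k)%N.
Proof. by rewrite size_cat size_takel size_tuple. Qed.

(** The labelling of G obtained by pulling back a labelling of the glued graph. *)
Definition lift_label t : 'I_(n + k) -> T := tnth (Tuple (size_period t)).

(** By [lower_neighbor] these are the labels at the smaller neighbours of v. *)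
Definition lower_labels t v : seq T :=
  drop (v - lower_degree v) (take v (t ++ take k t)).

Lemma lift_label_nth x0 t v : lift_label t v = nth x0 (t ++ take k t) v.
Proof. by rewrite /lift_label (tnth_nth x0). Qed.

Lemma mem_lower_labels t v x :
  reflect (exists u, [/\ (u < v)%N, G u v & lift_label t u = x]) (x \in lower_labels t v).
Proof.
have sz : size (take v (t ++ take k t)) = v.
  by rewrite size_takel // (eqP (size_period t)) ltnW.
apply: (iffP idP) => [/(nthP x)[i]|[u [uv Guv <-]]].
  rewrite /lower_labels size_drop sz => lt_i <-; set j := (v - lower_degree v + i)%N.
  have lt_j : (j < v)%N by rewrite /j; lia.
  pose u : 'I_(n + k) := Ordinal (ltn_trans lt_j (ltn_ord v)).
  exists u; split; first by [].
    by rewrite lower_neighbor // /= leq_addr.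
  by rewrite nth_drop nth_take // (lift_label_nth x).
rewrite lower_neighbor // in Guv.
apply/(nthP (lift_label t u)); exists (u - (v - lower_degree v))%N.
  by rewrite /lower_labels size_drop sz; lia.
by rewrite nth_drop subnKC // nth_take // -lift_label_nth.
Qed.

End Labellings.

Section Weights.

Variable N : nat.
Notation F := (ratfun N).
Variables (a : 'I_N -> seq 'I_N -> F) (w : 'I_N -> F).

Lemma step_weight_prod x0 h (rs : seq nat) g : size g = size rs ->
  step_weight a h rs g = \prod_(0 <= i < size rs)
    a (nth x0 g i) (marked (nth 0%N rs i) (h ++ take i g)).
Proof.
elim: rs h g => [|r rs IH] h [|y g] //= => [_|[szg]]; first by rewrite big_geq.
rewrite big_nat_recl //= cats0 IH //; congr (_ * _); apply: eq_bigr => i _.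
by rewrite cat_rcons.
Qed.

Lemma path_weight_prod (t : n.-tuple 'I_N) :
  path_weight a w k lower_degrees t =
  (\prod_(v : 'I_(n + k) | (k <= v)%N) a (lift_label t v) (lower_labels t v)) * \prod_(x <- t) w x.
Proof.
rewrite /path_weight; congr (_ * _).
have szd : size (drop k (t ++ take k t)) = size lower_degrees.
  by rewrite size_lower_degrees size_drop (eqP (size_period t)) addnK.
have [n0|n_gt0] := posnP n.
  have /size0nil -> : size lower_degrees = 0%N by rewrite size_lower_degrees.
  by rewrite big1 // => v kv; have := ltn_ord v; lia.
pose x0 := tnth t (Ordinal n_gt0).
rewrite (step_weight_prod x0) // size_lower_degrees.
pose H i := a (nth x0 (t ++ take k t) i)
  (marked (nth 0%N lower_degrees (i - k)) (take i (t ++ take k t))).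
transitivity (\prod_(k <= i < n + k) H i).
  have -> : \prod_(k <= i < n + k) H i = \prod_(0 <= i < n) H (i + k)%N.
    by rewrite -{1}[k]add0n big_addn addnK.
  apply: eq_bigr => i _; rewrite /H.
  rewrite nth_drop addnK [(i + k)%N]addnC takeD; congr (a _ (marked _ (_ ++ _))).
  by rewrite takel_cat // size_tuple.
rewrite big_geq_mkord; apply: eq_bigr => v kv.
rewrite /H -lift_label_nth nth_lower_degrees //; congr (a _ _).
rewrite /marked /lower_labels size_takel // (eqP (size_period t)).
exact: ltnW.
Qed.

End Weights.

End UnitIntervalGraph.

Lemma prod_natr_bool (R : comNzRingType) (I : finType) (P b : pred I) :
  \prod_(i | P i) (b i)%:R = [forall i, P i ==> b i]%:R :> R.
Proof.
have [/forallP Pb|] := boolP [forall i, P i ==> b i].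
  by rewrite big1 // => i /(implyP (Pb i)) ->.
rewrite negb_forall => /existsP[i]; rewrite negb_imply => /andP[Pi /negPf bi].
by rewrite (bigD1 i) //= bi mul0r.
Qed.

(** * The glued graph and its colourings *)

Section Gluing.

Variables (n k : nat) (G : rel 'I_(n + k)).
Hypothesis le_kn : (k <= n)%N.
Hypothesis G_nui : natural_unit_interval G.
Hypothesis G_first : clique G [pred p : 'I_(n + k) | (p < k)%N].
Hypothesis G_last : clique G [pred p : 'I_(n + k) | (n <= p)%N].
Implicit Types (p q u v : 'I_(n + k)) (i j : 'I_n).

Definition lies_over v i := (v == i :> nat) || (v == (n + i)%N :> nat).

Lemma lies_over_exists v : exists i, lies_over v i.
Proof.
rewrite /lies_over; have [vn|nv] := ltnP v n; first by exists (Ordinal vn); rewrite eqxx.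
have vn : (v - n < n)%N by have := ltn_ord v; lia.
by exists (Ordinal vn); rewrite /= subnKC // eqxx orbT.
Qed.

Lemma lies_over_inj v i j : lies_over v i -> lies_over v j -> i = j.
Proof.
by move=> vi vj; apply/val_inj => /=; move: vi vj; rewrite /lies_over;
  have := ltn_ord i; have := ltn_ord j; lia.
Qed.

Lemma lab_lies_over (T : eqType) (t : n.-tuple T) v i :
  lies_over v i -> lift_label le_kn t v = tnth t i.
Proof.
move=> vi; rewrite (lift_label_nth _ (tnth t i)) [RHS](tnth_nth (tnth t i)) nth_cat size_tuple.
have lt_v := ltn_ord v; have lt_i := ltn_ord i.
case/orP: vi => /eqP vi; rewrite vi; first by rewrite lt_i.
by rewrite ltnNge leq_addr addKn nth_take // -(ltn_add2l n) -vi.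
Qed.

Lemma uniq_take_lab (T : eqType) (t : n.-tuple T) :
  (forall p q, (p < k)%N -> (q < k)%N -> p != q -> lift_label le_kn t p != lift_label le_kn t q) <->
  uniq (take k t).
Proof.
have [k0|k_gt0] := posnP k.
  have -> : take k t = [::] by apply/size0nil; rewrite size_takel ?size_tuple // k0.
  by split=> // _ p q pk; move: (leq_trans pk (eq_leq k0)).
have n_gt0 : (0 < n)%N by apply: leq_trans k_gt0 le_kn.
pose x0 := tnth t (Ordinal n_gt0).
have szk : size (take k t) = k by rewrite size_takel ?size_tuple.
have labk p : (p < k)%N -> lift_label le_kn t p = nth x0 (take k t) p.
  by move=> pk; rewrite (lift_label_nth _ x0) nth_cat size_tuple (leq_trans pk) // nth_take.
split=> [lab_inj|uk p q pk qk pq]; last by rewrite !labk // nth_uniq ?szk.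
apply/(uniqP x0) => i j; rewrite !inE szk => ik jk eq_ij; apply/eqP; apply: contraT => ij.
have lt_nk m : (m < k)%N -> (m < n + k)%N by move=> mk; apply: ltn_addl.
have := lab_inj (Ordinal (lt_nk i ik)) (Ordinal (lt_nk j jk)) ik jk ij.
by rewrite !labk //= eq_ij eqxx.
Qed.

(** Every edge of the glued graph lifts to G. An edge whose larger end is at least k is tested at
    that end, and the remaining edges form the clique on the first k vertices, where properness
    means distinct colours. *)
Lemma proper_coloring_lab (T : eqType) (t : n.-tuple T) :
  proper_coloring (glue G) (tnth t) =
  uniq (take k t) &&
  [forall v : 'I_(n + k), (k <= v)%N ==> (lift_label le_kn t v \notin lower_labels G t v)].
Proof.
apply/idP/andP => [/forallP t_proper|[uk /forallP t_low]].
  have lab_neq p q : G p q -> lift_label le_kn t p != lift_label le_kn t q.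
    move=> Gpq; have [i pi] := lies_over_exists p; have [j qj] := lies_over_exists q.
    rewrite (lab_lies_over t pi) (lab_lies_over t qj).
    have /forallP/(_ j)/implyP := t_proper i; apply.
    by apply/existsP; exists p; apply/existsP; exists q; apply/and3P.
  split; first by apply/uniq_take_lab => p q pk qk pq; apply/lab_neq/G_first.
  apply/forallP => v; apply/implyP => _; apply/negP => /(mem_lower_labels le_kn G_nui)[u [uv Guv]].
  by move/eqP; rewrite (negPf (lab_neq u v Guv)).
have lab_neq p q : (p < q)%N -> G p q -> lift_label le_kn t p != lift_label le_kn t q.
  move=> pq Gpq; have [qk|kq] := ltnP q k.
    apply: (iffRL (uniq_take_lab t)) => //; first exact: ltn_trans pq qk.
    by rewrite neq_ltn pq.
  have := implyP (t_low q) kq; apply: contra => /eqP Dpq.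
  by apply/(mem_lower_labels le_kn G_nui); exists p.
apply/forallP => i; apply/forallP => j; apply/implyP => /existsP[p /existsP[q]].
case/and3P=> pi qj Gpq; rewrite -(lab_lies_over t pi) -(lab_lies_over t qj).
have [pq|qp|/val_inj pq] := ltngtP p q; first exact: lab_neq.
  by rewrite eq_sym lab_neq // (G_sym G_nui).
by have [_ iG _] := G_nui; rewrite pq iG in Gpq.
Qed.

Lemma chrom_poly_trace N :
  to_frac N (chrom_poly N (glue G)) =
  \tr (buildM (@color_a N) (@color_w N) k k (lower_degrees G)).
Proof.
rewrite (trace_expansion _ _ le_kn (size_lower_degrees G)); last first.
- exact: lower_degrees_admissible.
- by move=> y s _ sy; rewrite /color_a sy.
rewrite /chrom_poly rmorph_sum /=.
rewrite (reindex (fun t : n.-tuple 'I_N => [ffun i => tnth t i])) /=; last first.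
  exists (fun f : {ffun 'I_n -> 'I_N} => [tuple f i | i < n]) => [t _|f _].
    by apply: eq_from_tnth => i; rewrite tnth_mktuple ffunE.
  by apply/ffunP => i; rewrite ffunE tnth_mktuple.
rewrite big_mkcond [RHS]big_mkcond; apply: eq_bigr => t _.
have -> : proper_coloring (glue G) [ffun i => tnth t i] = proper_coloring (glue G) (tnth t).
  by apply: eq_forallb => i; apply: eq_forallb => j; rewrite !ffunE.
rewrite proper_coloring_lab; case: (uniq _) => //=.
rewrite (path_weight_prod G le_kn) big_tuple.
have -> : \prod_(v : 'I_(n + k) | (k <= v)%N)
    color_a (lift_label le_kn t v) (lower_labels G t v) =
  [forall v : 'I_(n + k), (k <= v)%N ==> (lift_label le_kn t v \notin lower_labels G t v)]%:R.
  exact: prod_natr_bool.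
case: ifP => _; last by rewrite mul0r.
rewrite mul1r rmorph_prod; apply: eq_bigr => i _.
by rewrite ffunE.
Qed.

End Gluing.

(** * Positivity *)

Lemma card_le_relation (I : finType) (A B : {set I}) (R : rel I) :
  (forall i, i \in A -> exists2 j, j \in B & R i j) ->
  (forall i i' j, i \in A -> i' \in A -> R i j -> R i' j -> i = i') ->
  (#|A| <= #|B|)%N.
Proof.
move=> R_ex R_inj; pose f i := odflt i [pick j in B | R i j].
have fP i : i \in A -> (f i \in B) && R i (f i).
  move=> iA; rewrite /f; case: pickP => [j //|/= no_j].
  by have [j jB Rij] := R_ex i iA; have := no_j j; rewrite jB Rij.
rewrite -(card_in_imset (f := f) (D := A)) => [|i i' iA i'A eq_f].
  by rewrite subset_leq_card //; apply/subsetP => _ /imsetP[i iA ->]; case/andP: (fP i iA).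
case/andP: (fP i iA) => _ Ri; case/andP: (fP i' i'A) => _.
by rewrite -eq_f => Ri'; apply: R_inj Ri Ri'.
Qed.

Lemma count_tuple n (T : eqType) (t : n.-tuple T) x :
  count_mem x t = #|[set i | tnth t i == x]|.
Proof.
by rewrite -sum1_count big_tuple -sum1_card; apply: eq_bigl => i; rewrite inE.
Qed.

(** Summation by parts, written multiplicatively. Monotonicity of [m] makes the truncated
    subtraction in the exponents exact. *)
Lemma prod_ratio_telescope (F : fieldType) (e : nat -> F) (m : nat -> nat) M :
  (forall c, (c <= M)%N -> e c != 0) -> (forall c, (m c.+1 <= m c)%N) -> e 0%N = 1 ->
  \prod_(0 <= c < M) (e c.+1 / e c) ^+ m c =
  (\prod_(0 <= c < M) e c.+1 ^+ (m c - m c.+1)) * e M ^+ m M.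
Proof.
move=> e_neq0 m_le e0; elim: M e_neq0 => [|M IH] e_neq0.
  by rewrite !big_geq // e0 expr1n mulr1.
rewrite !big_nat_recr //= IH => [|c cM]; last exact/e_neq0/leqW.
rewrite -mulrA -[RHS]mulrA; congr (_ * _).
rewrite -exprD subnK // expr_div_n mulrCA divff ?mulr1 //.
by rewrite expf_neq0 // e_neq0.
Qed.

Lemma prod_seq_count (R : comNzRingType) (T : finType) (f : T -> R) (s : seq T) :
  \prod_(x <- s) f x = \prod_x f x ^+ count_mem x s.
Proof.
elim: s => [|y s IH]; first by rewrite big_nil big1.
rewrite big_cons IH /=; under [RHS]eq_bigr do rewrite exprD.
rewrite big_split /=; congr (_ * _).
rewrite (bigD1 y) //= eqxx expr1 big1 ?mulr1 // => x /negPf xy.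
by rewrite eq_sym xy.
Qed.

Section LabelExpansion.

Variables (n k : nat) (G : rel 'I_(n + k)).
Hypothesis le_kn : (k <= n)%N.
Hypothesis G_nui : natural_unit_interval G.
Hypothesis G_last : clique G [pred p : 'I_(n + k) | (n <= p)%N].
Implicit Types (t : n.-tuple nat).

(** Labels are natural numbers here, so that the weight is independent of the number of
    variables. *)
Definition label_weight t : rat :=
  (uniq (take k t))%:R * \prod_(v : 'I_(n + k) | (k <= v)%N)
    Acoef (lift_label le_kn t v).+1 [seq x.+1 | x <- lower_labels G t v].

Definition e_exponent t c := (count_mem c t - count_mem c.+1 t)%N.

Lemma succ_pos (s : seq nat) : 0%N \notin [seq x.+1 | x <- s].
Proof. by apply/mapP => -[]. Qed.

Lemma label_weight_ge0 t : 0 <= label_weight t.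
Proof. by rewrite mulr_ge0 ?ler0n // prodr_ge0 // => v _; rewrite Acoef_ge0 ?succ_pos. Qed.

Section NonzeroWeight.

Variable t : n.-tuple nat.
Hypothesis t_neq0 : label_weight t != 0.

Lemma Acoef_neq0 (v : 'I_(n + k)) : (k <= v)%N ->
  Acoef (lift_label le_kn t v).+1 [seq x.+1 | x <- lower_labels G t v] != 0.
Proof.
move=> kv; move: t_neq0; rewrite mulf_eq0 negb_or => /andP[_].
by move/prodf_neq0; apply.
Qed.

Lemma lab_notin_lower (v : 'I_(n + k)) : (k <= v)%N ->
  lift_label le_kn t v \notin lower_labels G t v.
Proof.
move=> kv; apply: contra (Acoef_neq0 kv) => lab_v.
by rewrite Acoef_mem ?succ_pos // map_f.
Qed.

Lemma lab_predecessor (v : 'I_(n + k)) c : (k <= v)%N -> lift_label le_kn t v = c.+1 ->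
  exists u : 'I_(n + k), [/\ (u < v)%N, G u v & lift_label le_kn t u = c].
Proof.
move=> kv lab_v; apply/(mem_lower_labels le_kn G_nui).
have := Acoef_neq0 kv; rewrite lab_v /Acoef /=.
by rewrite (mem_map (f := succn)) => [|x y []//]; case: ifP; rewrite ?eqxx.
Qed.

Definition precedes (i j : 'I_n) : bool :=
  [exists v : 'I_(n + k), exists u : 'I_(n + k),
    [&& (k <= v)%N, (u < v)%N, G u v, lies_over v i & lies_over u j]].

(* If i and i' differ, their lifts are larger neighbours of one lift of j, hence adjacent,
   or the gluing separates them and shifting the larger lift down by n makes it
   adjacent to the other one; equal labels on adjacent vertices make the weight 0. *)
Lemma precedes_inj c (i i' j : 'I_n) : tnth t i = c -> tnth t i' = c ->
  precedes i j -> precedes i' j -> i = i'.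
Proof.
suff main (v v' u u' : 'I_(n + k)) (b b' : 'I_n) : tnth t b = c -> tnth t b' = c ->
    (k <= v)%N -> (u < v)%N -> G u v -> lies_over v b -> lies_over u j ->
    (k <= v')%N -> (u' < v')%N -> G u' v' -> lies_over v' b' -> lies_over u' j ->
    (u < u')%N || ((u == u') && (v < v')%N) -> False.
  move=> ti ti' /existsP[v /existsP[u /and5P[kv uv Guv vi uj]]].
  case/existsP=> v' /existsP[u' /and5P[kv' uv' Guv' vi' uj']].
  have [uu'|uu'|/val_inj uu'] := ltngtP u u'.
  - by case: (main v v' u u' i i'); rewrite ?uu'.
  - by case: (main v' v u' u i' i); rewrite ?uu'.
  rewrite -{}uu' in uv' Guv' uj' *; have [vv'|vv'|/val_inj vv'] := ltngtP v v'.
  - by case: (main v v' u u i i'); rewrite ?vv' ?eqxx ?orbT.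
  - by case: (main v' v u u i' i); rewrite ?vv' ?eqxx ?orbT.
  by apply: (lies_over_inj le_kn vi); rewrite vv'.
move=> tb tb' kv uv Guv vb uj kv' uv' Guv' vb' uj' /orP[uu'|/andP[/eqP uu' vv']].
  have ltv' := ltn_ord v'; have ltj := ltn_ord j.
  have [u_j u'_j] : u = j :> nat /\ u' = (n + j)%N :> nat.
    by move: uj uj'; rewrite /lies_over => /orP[] /eqP ? /orP[] /eqP ?; lia.
  have lt_s : (v' - n < n + k)%N by lia.
  pose s : 'I_(n + k) := Ordinal lt_s; have [us sv] : (u < s)%N /\ (s < v)%N by rewrite /s /=; lia.
  have /andP[_ Gsv] := G_between G_nui us sv Guv.
  have ltb' := ltn_ord b'.
  have sb' : lies_over s b' by move: vb'; rewrite /lies_over /s /=; lia.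
  move/negP: (lab_notin_lower kv); apply; apply/(mem_lower_labels le_kn G_nui).
  by exists s; rewrite (lab_lies_over _ _ sb') (lab_lies_over _ _ vb) tb tb'.
rewrite -uu' in uv' Guv'; have /andP[_ Gvv'] := G_between G_nui uv vv' Guv'.
move/negP: (lab_notin_lower kv'); apply; apply/(mem_lower_labels le_kn G_nui).
by exists v; rewrite (lab_lies_over _ _ vb) (lab_lies_over _ _ vb') tb tb'.
Qed.

Lemma count_label_succ c : (count_mem c.+1 t <= count_mem c t)%N.
Proof.
rewrite !count_tuple; apply: (card_le_relation (R := precedes)) => [i|i i' j]; last first.
  by rewrite !inE => /eqP ti /eqP ti'; apply: precedes_inj ti ti'.
rewrite inE => /eqP ti.
(* Only the vertices from k on carry a factor A. Each class has a lift among them: i itself, or n +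
   i when i < k, as k <= n. *)
have [v [kv vi]] : exists v : 'I_(n + k), (k <= v)%N /\ lies_over v i.
  have lt_i := ltn_ord i; have [ki|ik] := leqP k i.
    have lt_v : (i < n + k)%N by lia.
    by exists (Ordinal lt_v); rewrite /lies_over /= eqxx.
  have lt_v : (n + i < n + k)%N by lia.
  by exists (Ordinal lt_v); rewrite /lies_over /= eqxx orbT; split=> //; lia.
have lab_v : lift_label le_kn t v = c.+1 by rewrite (lab_lies_over _ _ vi).
have [u [uv Guv lab_u]] := lab_predecessor kv lab_v.
have [j uj] := lies_over_exists le_kn u.
exists j; first by rewrite inE -(lab_lies_over le_kn _ uj) lab_u.
by apply/existsP; exists v; apply/existsP; exists u; rewrite kv uv Guv vi uj.
Qed.

(** By [count_label_succ] every label below x occurs as well, which gives x + 1 distinct values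
    among n entries. *)
Lemma label_lt x : x \in t -> (x < n)%N.
Proof.
move=> xt; rewrite -[x.+1](size_iota 0) -[leqRHS](size_tuple t); apply: uniq_leq_size.
  exact: iota_uniq.
move=> y; rewrite mem_iota ltnS => /andP[_ yx]; rewrite -has_pred1 has_count.
elim: x xt yx => [|x IH] xt; first by rewrite leqn0 => /eqP ->; rewrite -has_count has_pred1.
rewrite leq_eqVlt => /orP[/eqP ->|]; first by rewrite -has_count has_pred1.
rewrite ltnS => yx; apply: IH => //; rewrite -has_pred1 has_count.
by apply: leq_trans (count_label_succ x); rewrite -has_count has_pred1.
Qed.

End NonzeroWeight.

Section FiniteVariables.

Variable N : nat.
Hypothesis G_first : clique G [pred p : 'I_(n + k) | (p < k)%N].

Definition nat_labels (t : n.-tuple 'I_N) : n.-tuple nat := map_tuple val t.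

Lemma lab_nat_labels (t : n.-tuple 'I_N) v :
  lift_label le_kn (nat_labels t) v = lift_label le_kn t v.
Proof.
rewrite (lift_label_nth le_kn (lift_label le_kn t v : nat)).
rewrite (lift_label_nth le_kn (lift_label le_kn t v) t).
by rewrite /= -map_take -map_cat (nth_map (lift_label le_kn t v)) // (eqP (size_period le_kn t)).
Qed.

Lemma lower_nat_labels (t : n.-tuple 'I_N) v :
  lower_labels G (nat_labels t) v = [seq val x | x <- lower_labels G t v].
Proof. by rewrite /lower_labels map_drop map_take map_cat map_take. Qed.

Lemma label_w_prod (t : n.-tuple 'I_N) : label_weight (nat_labels t) != 0 ->
  \prod_(x <- t) label_w x =
  to_frac N (\prod_(c < N) mesym N rat c.+1 ^+ e_exponent (nat_labels t) c).
Proof.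
move=> t_neq0; rewrite prod_seq_count.
pose e c := to_frac N (mesym N rat c); pose m c := count_mem c (nat_labels t).
have mE (x : 'I_N) : count_mem x t = m x.
  by rewrite /m count_map; apply: eq_count => y; rewrite /= val_eqE.
have e_neq0 c : (c <= N)%N -> e c != 0 by exact: to_frac_mesym_neq0.
have e0 : e 0%N = 1 by rewrite /e mesym0E rmorph1.
have := prod_ratio_telescope e_neq0 (count_label_succ t_neq0) e0.
(* No label equals N, so the boundary factor of the telescoping product is 1. *)
have -> : count_mem N (nat_labels t) = 0%N.
  by apply/count_memPn/mapP => -[x _ Dx]; have := ltn_ord x; rewrite -Dx ltnn.
rewrite expr0 mulr1 !big_mkord rmorph_prod => E.
transitivity (\prod_(c < N) (e c.+1 / e c) ^+ m c).
  by apply: eq_bigr => x _; rewrite mE.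
by rewrite E; apply: eq_bigr => c _; rewrite rmorphXn.
Qed.

(** The trace over colours is replaced by the trace over labels, whose weights are nonnegative
    rationals times monomials in the e_c. *)
Lemma chrom_poly_expansion :
  chrom_poly N (glue G) = \sum_(t : n.-tuple 'I_N)
    label_weight (nat_labels t) *:
      \prod_(c < N) mesym N rat c.+1 ^+ e_exponent (nat_labels t) c.
Proof.
apply: (@to_frac_inj N); rewrite (chrom_poly_trace le_kn) // -trace_label_color.
rewrite (trace_expansion _ _ le_kn (size_lower_degrees G)); last first.
- exact: lower_degrees_admissible.
- exact: (es_mem (label_system N)).
rewrite big_mkcond rmorph_sum; apply: eq_bigr => t _.
rewrite -mul_mpolyC rmorphM -[to_frac N _%:MP]/(rat_to_frac N _).
have uE : uniq (take k t) = uniq (take k (nat_labels t)).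
  by rewrite -map_take map_inj_uniq //; apply: val_inj.
rewrite path_weight_prod uE.
have aE : \prod_(v : 'I_(n + k) | (k <= v)%N) label_a (lift_label le_kn t v) (lower_labels G t v) =
    rat_to_frac N (\prod_(v : 'I_(n + k) | (k <= v)%N)
      Acoef (lift_label le_kn (nat_labels t) v).+1
        [seq x.+1 | x <- lower_labels G (nat_labels t) v]).
  rewrite rmorph_prod; apply: eq_bigr => v _.
  by rewrite label_aE lab_nat_labels lower_nat_labels -map_comp.
(* [label_w_prod] is available for nonzero weight only; for weight 0 both terms vanish. *)
have [t0|t_neq0] := eqVneq (label_weight (nat_labels t)) 0.
  rewrite t0 rmorph0 mul0r; case: ifP => // ut.
  by move: t0; rewrite /label_weight ut mul1r aE => ->; rewrite rmorph0 mul0r.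
rewrite -label_w_prod // aE /label_weight; case: ifP => [_|ut]; first by rewrite mul1r.
by rewrite /label_weight ut mul0r eqxx in t_neq0.
Qed.

Lemma chrom_poly_e_positive : e_positive_poly (chrom_poly N (glue G)).
Proof.
exists (\sum_(t : n.-tuple 'I_N) label_weight (nat_labels t) *:
  'X_[[multinom e_exponent (nat_labels t) c | c < N]]); split=> [m|].
  rewrite raddf_sum sumr_ge0 // => t _.
  by rewrite /= mcoeffZ mcoeffX mulr_ge0 ?label_weight_ge0 // ler0n.
rewrite chrom_poly_expansion raddf_sum; apply: eq_bigr => t _ /=.
rewrite comp_mpolyZ comp_mpolyX; congr (_ *: _); apply: eq_bigr => c _.
by rewrite mnmE tnth_mktuple.
Qed.

End FiniteVariables.

End LabelExpansion.

Local Open Scope mset_scope.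

(** * Infinitely many variables *)

Section Truncation.

Variable N : nat.
Implicit Types (m : {mset nat}) (f g : series) (p q : {mpoly rat[N]}).

Definition supported m := forall c, (N <= c)%N -> m c = 0%N.

Definition monomial_of m : 'X_{1..N} := [multinom m i | i < N].

(* p is obtained from f by setting the variables x_c with c >= N to 0. *)
Definition represents p f := forall m, supported m -> f m = p@_(monomial_of m).

Lemma supported_lt m c : supported m -> c \in finsupp m -> (c < N)%N.
Proof. by move=> sm; rewrite mem_finsupp ltnNge; apply: contra => /sm/eqP. Qed.

Lemma submsetE m (a : {dffun forall c : finsupp m, 'I_(m (val c)).+1}) c :
  submset a c = if insub c is Some c' then a c' : nat else 0%N.
Proof.
by rewrite /submset fsfun_ffun; case: insub.
Qed.

Lemma submset_le m (a : {dffun forall c : finsupp m, 'I_(m (val c)).+1}) c :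
  (submset a c <= m c)%N.
Proof.
rewrite submsetE; case: insubP => // u cm <-.
by rewrite -ltnS ltn_ord.
Qed.

Lemma represents_series1 : represents 1 series1.
Proof.
move=> m sm; rewrite /series1 mcoeff1; congr (nat_of_bool _)%:R.
apply/eqP/eqP => [->|/mnmP m0]; first by apply/mnmP => i; rewrite !mnmE mset0E.
apply/msetP => c; rewrite mset0E; have [cN|/sm//] := ltnP c N.
by have := m0 (Ordinal cN); rewrite !mnmE.
Qed.

Lemma size_sum_count (s : seq nat) : all (fun c => (c < N)%N) s ->
  size s = (\sum_(i < N) count_mem (i : nat) s)%N.
Proof.
elim: s => [|c s IH] /=; first by rewrite big1.
case/andP=> cN /IH ->; rewrite big_split /= [X in _ = (X + _)%N](bigD1 (Ordinal cN)) //=.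
rewrite eqxx [X in (_ + X + _)%N]big1 //.
by move=> i; rewrite -val_eqE /= eq_sym => /negPf ->.
Qed.

Lemma represents_e_series i : represents (mesym N rat i) (e_series i).
Proof.
move=> m sm; rewrite /e_series mcoeff_mesym; congr (nat_of_bool _)%:R.
have lt_m : all (fun c => (c < N)%N) m.
  by apply/allP => c; rewrite -multiset.msuppE; apply: supported_lt.
rewrite /mechar andbC size_sum_count // mdegE.
congr (_ && _); first by congr (_ == _); apply: eq_bigr => c _; rewrite mnmE count_mem_mset.
apply/idP/forallP => [um c|m_le1].
  by rewrite mnmE -count_mem_mset count_uniq_mem // leq_b1.
apply: count_mem_uniq => c; have [cN|Nc] := ltnP c N.
  have := m_le1 (Ordinal cN); rewrite mnmE count_mem_mset -mset_gt0 /=.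
  by case: (m c) => [|[|]].
by rewrite count_mem_mset -mset_gt0 sm.
Qed.

(** As m is supported below N, its sub-multisets are the divisors of its monomial, and reindexing by
    [unsub] matches the two Cauchy products. *)
Lemma represents_mul p q f g : represents p f -> represents q g ->
  represents (p * q) (series_mul f g).
Proof.
move=> pf qg m sm; rewrite (mcoeff_poly_mul_lin p q (ltnSn (mdeg (monomial_of m)))).
pose sub (a : {dffun forall c : finsupp m, 'I_(m (val c)).+1}) := monomial_of (submset a).
have sub_le a : (sub a <= monomial_of m)%MM by apply/mnm_lepP => i; rewrite !mnmE submset_le.
have sub_bound a : (mdeg (sub a) < (mdeg (monomial_of m)).+1)%N.
  rewrite ltnS !mdegE; apply: leq_sum => i _; by have /mnm_lepP := sub_le a.
pose ext (h : 'X_{1..N}) c := if insub c is Some i then h i else 0%N.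
pose unsub (h : 'X_{1..N < (mdeg (monomial_of m)).+1}) :
    {dffun forall c : finsupp m, 'I_(m (val c)).+1} :=
  [ffun c => inord (ext h (val c))].
rewrite (reindex_onto (fun a => BMultinom (sub_bound a)) unsub) /=; last first.
  move=> h /mnm_lepP hm; apply/val_inj/mnmP => i; rewrite /= mnmE submsetE.
  have := hm i; rewrite mnmE; case: insubP => [u um ui hmi|ni]; last first.
    by rewrite fsfun_dflt // leqn0 => /eqP ->.
  by rewrite ffunE /ext ui valK inordK // ltnS.
rewrite /series_mul (eq_bigl xpredT) => [|a]; last first.
  rewrite sub_le /=; apply/eqP/ffunP => c; apply/val_inj.
  have cN : (val c < N)%N := supported_lt sm (valP c).
  rewrite ffunE /ext insubT /= mnmE submsetE /= valK inordK //.
apply: eq_bigr => a _.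
have ssub : supported (submset a).
  by move=> c /sm mc; apply/eqP; rewrite -leqn0; apply: leq_trans (submset_le a c) _; rewrite mc.
rewrite pf // qg; last by move=> c Nc; rewrite msetE2 (sm c).
congr (_ * _@_ _); apply/mnmP => i; rewrite !mnmE.
by rewrite msetE2.
Qed.

Lemma represents_e_part la : represents (\prod_(i <- la) mesym N rat i) (e_part la).
Proof.
elim: la => [|i la IH] /=; first by rewrite big_nil; apply: represents_series1.
by rewrite big_cons; apply: represents_mul IH; apply: represents_e_series.
Qed.

End Truncation.

Lemma count_enum (T : finType) (P : pred T) : count P (enum T) = #|P|.
Proof. by rewrite -sum1_count big_enum_cond sum1_card. Qed.

(** A colouring with monomial m uses only colours in the support of m, so [lift] is a bijection onto
    the colourings by ['I_N] that contribute to m. *)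
Lemma represents_chrom_series N (T : finType) (e : rel T) :
  represents (chrom_poly N e) (chrom_series e).
Proof.
move=> m sm; pose io (c : finsupp m) : 'I_N := Ordinal (supported_lt sm (valP c)).
have io_inj : injective io by move=> c d /(congr1 val) cd; apply: val_inj.
pose lift (kappa : {ffun T -> finsupp m}) : {ffun T -> 'I_N} := [ffun v => io (kappa v)].
have lift_inj : injective lift.
  by move=> f g /ffunP fg; apply/ffunP => v; have := fg v; rewrite !ffunE => /io_inj.
rewrite /chrom_poly raddf_sum /= /chrom_series.
transitivity (\sum_(kappa : {ffun T -> 'I_N} | proper_coloring e kappa)
    (monomial_of N m == (\sum_v U_(kappa v))%MM)%:R : rat); last first.
  apply: eq_bigr => kappa _.
  by rewrite mprodXE mcoeffX eq_sym.
transitivity (#|[pred kappa : {ffun T -> 'I_N} | proper_coloring e kappa &&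
    (monomial_of N m == (\sum_v U_(kappa v))%MM)]|%:R : rat); last first.
  rewrite -sum1_card natr_sum /= big_mkcondr; apply: eq_bigr => kappa _.
  by case: ifP.
congr (_%:R).
rewrite -(card_imset _ lift_inj); apply: eq_card => kappa.
have sumE (f : T -> 'I_N) (i : 'I_N) : (\sum_v U_(f v))%MM i = #|[pred v | f v == i]|.
  rewrite mnm_sumE -sum1_card [RHS]big_mkcond; apply: eq_bigr => v _.
  by rewrite mnm1E inE; case: eqP.
rewrite inE; apply/imsetP/andP => [[f]|[prop_k /eqP mk]].
  rewrite inE => /andP[prop_f /eqP mf] ->; split.
    apply/forallP => u; apply/forallP => v; apply/implyP => uv.
    have := implyP (forallP (forallP prop_f u) v) uv; apply: contra => /eqP.
    by rewrite !ffunE => /io_inj ->.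
  apply/eqP/mnmP => i; rewrite mnmE sumE -[in LHS]mf mset_seqE count_map count_enum.
  by apply: eq_card => v; rewrite !inE ffunE -val_eqE.
have kappa_m v : val (kappa v) \in finsupp m.
  rewrite mem_finsupp; have /mnmP/(_ (kappa v)) := mk; rewrite mnmE sumE => ->.
  by rewrite -lt0n; apply/card_gt0P; exists v; rewrite inE.
exists [ffun v => [` kappa_m v]%fset]; last first.
  by apply/ffunP => v; rewrite !ffunE; apply: val_inj.
rewrite inE; apply/andP; split.
  apply/forallP => u; apply/forallP => v; apply/implyP => uv; rewrite !ffunE.
  have := implyP (forallP (forallP prop_k u) v) uv; apply: contra => /eqP/(congr1 val) /= uv'.
  by apply/eqP/val_inj.
apply/eqP/msetP => c; rewrite mset_seqE count_map count_enum.
have [cN|Nc] := ltnP c N.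
  have /mnmP/(_ (Ordinal cN)) := mk; rewrite mnmE sumE => ->.
  by apply: eq_card => v; rewrite !inE ffunE -val_eqE.
rewrite sm //; apply: eq_card0 => v; rewrite !inE ffunE /=.
by apply/negbTE; rewrite neq_ltn (leq_trans (ltn_ord _) Nc).
Qed.

(** Together with [label_lt] this makes the expansion stable: beyond n variables no new labellings
    contribute. *)
Lemma sum_nat_labels n N (V : nmodType) (H : n.-tuple nat -> V) :
  (n <= N)%N -> (forall t, H t != 0 -> forall x, x \in t -> (x < n)%N) ->
  \sum_(t : n.-tuple 'I_N) H (nat_labels t) = \sum_(t : n.-tuple 'I_n) H (nat_labels t).
Proof.
move=> nN Hlt; pose wid (t : n.-tuple 'I_n) : n.-tuple 'I_N := map_tuple (widen_ord nN) t.
have wid_inj : injective wid.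
  move=> t t' /(congr1 val) /= /inj_map eq_t; apply/val_inj/eq_t => x y /(congr1 val) /=.
  exact: val_inj.
have wid_nat t : nat_labels (wid t) = nat_labels t.
  by apply: val_inj; rewrite /= -map_comp; apply: eq_map.
rewrite -(eq_bigr _ (fun t _ => congr1 H (wid_nat t))).
rewrite -(big_imset (h := wid) (A := predT) (fun t => H (nat_labels t))) /=; last exact: in2W.
rewrite [LHS](bigID (mem (wid @: predT))) /= [X in _ + X]big1 ?addr0 // => t.
apply: contraNeq => /Hlt t_lt; apply/imsetP.
have lt_t i : (tnth t i < n)%N.
  by apply: t_lt; rewrite /= map_f // mem_tnth.
exists [tuple Ordinal (lt_t i) | i < n] => //.
by apply: eq_from_tnth => i; rewrite tnth_map tnth_mktuple; apply: val_inj.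
Qed.

Section Series.

Variables (n k : nat) (G : rel 'I_(n + k)).
Hypothesis le_kn : (k <= n)%N.
Hypothesis G_nui : natural_unit_interval G.
Hypothesis G_first : clique G [pred p : 'I_(n + k) | (p < k)%N].
Hypothesis G_last : clique G [pred p : 'I_(n + k) | (n <= p)%N].

(** If the counts of the labels 0, 1, ... decrease, they form a partition, and this is its
    conjugate. *)
Definition label_partition (t : n.-tuple nat) : seq nat :=
  sort geq (flatten [seq nseq (e_exponent t c) c.+1 | c <- iota 0 n]).

Lemma label_partitionP t : is_partition (label_partition t).
Proof.
rewrite /is_partition sort_sorted => [|x y]; last exact: leq_total.
rewrite mem_sort; apply/flattenP => -[_ /mapP[c _ ->]].
by rewrite mem_nseq => /andP[].
Qed.

Lemma prod_label_partition N (t : n.-tuple nat) : (n <= N)%N ->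
  label_weight G le_kn t != 0 ->
  \prod_(c < N) mesym N rat c.+1 ^+ e_exponent t c =
  \prod_(i <- label_partition t) mesym N rat i.
Proof.
move=> nN t_neq0; rewrite (perm_big _ (permEl (perm_sort _ _))) /= big_flatten big_map.
under [RHS]eq_bigr do rewrite big_nseq -Monoid.iteropE -/(GRing.exp _ _).
rewrite -(big_mkord xpredT (fun c => mesym N rat c.+1 ^+ e_exponent t c)).
rewrite (big_cat_nat (leq0n n) nN) /= [X in _ * X]big_nat_cond [X in _ * X]big1 ?mulr1 => [|c].
  by rewrite /index_iota subn0.
rewrite andbT => /andP[nc _]; rewrite /e_exponent (_ : count_mem c t = 0%N) //.
apply/count_memPn/negP => /(label_lt G_nui t_neq0); by rewrite ltnNge nc.
Qed.

Lemma chrom_series_e_positive : e_positive (chrom_series (glue G)).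
Proof.
pose part (t : n.-tuple 'I_n) := label_partition (nat_labels t).
pose lw (t : n.-tuple 'I_n) := label_weight G le_kn (nat_labels t).
exists (undup [seq part t | t <- enum {: n.-tuple 'I_n}]).
exists (fun la => \sum_(t | part t == la) lw t); split.
- exact: undup_uniq.
- by apply/allP => la; rewrite mem_undup => /mapP[t _ ->]; apply: label_partitionP.
- by move=> la _; rewrite sumr_ge0 // => t _; apply: label_weight_ge0.
(* The number N of variables may depend on m because the coefficients chosen above do not involve
   it. It is at least n and exceeds every colour in the support of m. *)
move=> m; pose N := maxn n (\max_(c <- finsupp m) c.+1).
have nN : (n <= N)%N by apply: leq_maxl.
have sm : supported N m.
  move=> c; rewrite leqNgt => cN; apply/eqP; apply: contraR cN => mc; rewrite leq_max.
  by rewrite (big_rem c) ?mem_finsupp //= leq_max leqnn orbT.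
transitivity (\sum_t lw t * e_part (part t) m).
  rewrite (represents_chrom_series _ sm) (chrom_poly_expansion le_kn G_nui G_last) //.
  rewrite raddf_sum /=.
  pose H (t : n.-tuple nat) := label_weight G le_kn t * e_part (label_partition t) m.
  transitivity (\sum_(t : n.-tuple 'I_N) H (nat_labels t)).
    apply: eq_bigr => t _; rewrite mcoeffZ /H.
    have [->|t_neq0] := eqVneq (label_weight G le_kn (nat_labels t)) 0; first by rewrite !mul0r.
    by rewrite prod_label_partition // (represents_e_part _ sm).
  apply: sum_nat_labels nN _ => t; rewrite mulf_eq0 negb_or => /andP[t_neq0 _].
  by move=> x; apply: (label_lt G_nui t_neq0).
under [RHS]eq_bigr do rewrite mulr_suml.
rewrite (exchange_big_dep predT) //=; apply: eq_bigr => t _.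
rewrite big_mkcond (bigD1_seq (part t)) ?undup_uniq ?mem_undup ?map_f //=; last first.
  by rewrite -enumT mem_enum.
by rewrite eqxx big1 ?addr0 // => la /negPf la_t; rewrite eq_sym la_t.
Qed.

End Series.

Lemma MG_buildM N n k (G : rel 'I_(n + k)) :
  MG N G = buildM (@label_a N) (@label_w N) k k (lower_degrees G).
Proof. by []. Qed.

Theorem theorem21 (R : realType) (n k : nat) (G : rel 'I_(n + k))
    (le_kn : (k <= n)%N)
    (G_nui : natural_unit_interval G)
    (G_first : clique G [pred p : 'I_(n + k) | (p < k)%N])
    (G_last : clique G [pred p : 'I_(n + k) | (n <= p)%N])
    (Gamma_loopless : irreflexive (glue G))
    (Gamma_pca : proper_circular_arc R (glue G)) :
  (forall N : nat,
     tofrac (chrom_poly N (glue G)) = \tr (MG N G) /\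
     e_positive_poly (chrom_poly N (glue G))) /\
  e_positive (chrom_series (glue G)).
Proof.
split=> [N|]; last exact: chrom_series_e_positive.
split; last exact: chrom_poly_e_positive.
by rewrite MG_buildM trace_label_color -chrom_poly_trace.
Qed.
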